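(* Let $w=(w_1,\ldots,w_m)$ be positive weights with $w_1+\cdots+w_m=1$, let $A_1,\ldots,A_m\in\mathrm{UT}_n$, and let $X=G(w;A_1,\ldots,A_m)$ be the $w$-weighted Karcher mean on $\mathrm{UT}_n$. Set $$D=\mathrm{diag}(A_1^{w_1}\cdots A_m^{w_m}),\qquad A_{(i)}=D^{-1}A_i.$$ Then $X=DX'$, where $X'=G(w;A_{(1)},\ldots,A_{(m)})$ is unipotent upper triangular. Moreover, $X'$ can be computed recursively as follows. For $1\le\ell\le n$, define $X'_\ell:=X'[1:\ell]$ and $A_{(i,\ell)}:=A_{(i)}[1:\ell]$ for $i=1,\ldots,m$. (1) $\mathrm{diag}(X')=I_n$. (2) Suppose that $X'_{\ell-1}$ has been determined for some $1<\ell\le n$. Then $$X'_\ell=\begin{bmatrix}X'_{\ell-1}&y'_{\ell-1}\\0&1\end{bmatrix},$$ where $y'_{\ell-1}\in\mathbb{R}^{\ell-1}$ is determined as follows. Write $$A_{(i,\ell)}=\begin{bmatrix}A_{(i,\ell-1)}&b_{(i,\ell-1)}\\0&a^{(i)}_{\ell\ell}\end{bmatrix}$$ and define $$G_{i,\ell-1}=\log^{[1]}\!\left((X'_{\ell-1})^{-1}A_{(i,\ell-1)},\;a^{(i)}_{\ell\ell}I_{\ell-1}\right).$$ Then $$y'_{\ell-1}=X'_{\ell-1}\left(\sum_{i=1}^m w_i a^{(i)}_{\ell\ell}\,G_{i,\ell-1}\right)^{-1}\left[\sum_{i=1}^m w_i\,G_{i,\ell-1}(X'_{\ell-1})^{-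1}b_{(i,\ell-1)}\right].$$
   Context: $\mathrm{UT}_n$ is the Lie group of $n\times n$ real upper triangular matrices with positive diagonal entries; $\log:\mathrm{UT}_n\to\mathfrak{ut}_n$ is the inverse of the matrix exponential $\exp:\mathfrak{ut}_n\to\mathrm{UT}_n$, where $\mathfrak{ut}_n$ is the space of real upper triangular $n\times n$ matrices, and $A^{w}=\exp(w\log A)$. The $w$-weighted Karcher mean $G(w;A_1,\ldots,A_m)$ is the (unique) solution $X\in\mathrm{UT}_n$ of $\sum_{i=1}^m w_i\log(X^{-1}A_i)=0$. ''Unipotent upper triangular'' means upper triangular with all diagonal entries equal to $1$. $\mathrm{diag}(A)$ is the diagonal matrix formed from the diagonal entries of $A$. $A[i:j]$ is the principal submatrix with rows and columns indexed by $\{i,\ldots,j\}$. For $s,t>0$, $\log^{[1]}(s,t)=\frac{\log s-\log t}{s-t}$ if $s\neq t$ and $\log^{[1]}(s,s)=1/s$. For $T\in\mathrm{UT}_k$ and $t>0$, $\log^{[1]}(T,tI_k)$ denotes the analytic functional calculus of $\log^{[1]}$ applied to the commuting pair $(T,tI_k)$; equivalently it is $g(T)$ for the analytic function $g(x)=\log^{[1]}(x,t)$ (so it equals $(\log(T)-\log(t)I_k)(T-tI_k)^{-1}$ when $t$ is not a diagonal entry of $T$). *)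

(* Defs.v *)
From HB Require Import structures.
From mathcomp Require Import all_boot all_order all_algebra.
From mathcomp Require Import all_classical all_reals all_analysis.

Set Implicit Arguments.
Unset Strict Implicit.
Unset Printing Implicit Defensive.

Import Order.TTheory GRing.Theory Num.Theory.
Import numFieldNormedType.Exports.

Local Open Scope classical_set_scope.
Local Open Scope ring_scope.

(* [is_trig_mx] means lower triangular, hence the transpose. *)
Definition upper_mx (R : realType) (n : nat) (A : 'M[R]_n) : Prop :=
  is_trig_mx A^T.

Definition UT (R : realType) (n : nat) (A : 'M[R]_n) : Prop :=
  upper_mx A /\ forall i, 0 < A i i.

Definition unipotent_upper (R : realType) (n : nat) (A : 'M[R]_n) : Prop :=
  upper_mx A /\ forall i, A i i = 1.

Definition diag_part (R : realType) (n : nat) (A : 'M[R]_n) : 'M[R]_n :=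
  diag_mx (\row_i A i i).

Definition expm (R : realType) (n : nat) (A : 'M[R]_n) : 'M[R]_n :=
  limn (series (fun k : nat => (k`!%:R)^-1 *: A ^+ k)).

(* The inverse of exp : ut_n -> UT_n; exp is a bijection between these sets,
   so on UT_n the default value 0 is never used. *)
Definition logm (R : realType) (n : nat) (A : 'M[R]_n) : 'M[R]_n :=
  xget 0 [set L : 'M[R]_n | upper_mx L /\ expm L = A].

Definition powm (R : realType) (n : nat) (A : 'M[R]_n) (s : R) : 'M[R]_n :=
  expm (s *: logm A).

Definition karcher_eq (R : realType) (m n : nat) (w : 'I_m -> R)
    (A : 'I_m -> 'M[R]_n) (X : 'M[R]_n) : Prop :=
  UT X /\ \sum_(i < m) w i *: logm (invmx X *m A i) = 0.

(* The unique solution of the Karcher equation in UT_n. *)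
Definition karcher (R : realType) (m n : nat) (w : 'I_m -> R)
    (A : 'I_m -> 'M[R]_n) : 'M[R]_n :=
  xget 0 [set X : 'M[R]_n | karcher_eq w A X].

Definition log_dd (R : realType) (s t : R) : R :=
  if s == t then s^-1 else (ln s - ln t) / (s - t).

(* Analytic functional calculus on a disc: f is the sum of a power series
   about c on |x - c| < r, this disc contains the spectrum of T, and
   f(T) = \sum_k a_k (T - c I)^k.  It is meant for matrices with real spectrum
   (e.g. triangular ones); f(T) then does not depend on the disc chosen.
   For f = log_dd^~ t with t > 0 and positive spectrum a disc always exists: f
   is analytic on the right half-plane, so every c larger than half of the
   largest eigenvalue works with r = c. *)
Definition is_afc (R : realType) (n : nat) (f : R -> R) (T B : 'M[R]_n) : Prop :=
  exists (c r : R) (a : nat -> R),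
    [/\ forall x : R, `|x - c| < r -> pseries a (x - c) @ \oo --> f x,
        forall l : R, eigenvalue T l -> `|l - c| < r
      & series (fun k : nat => a k *: (T - c%:M) ^+ k) @ \oo --> B].

Definition afc (R : realType) (n : nat) (f : R -> R) (T : 'M[R]_n) : 'M[R]_n :=
  xget 0 [set B : 'M[R]_n | is_afc f T B].

Definition log1_mx (R : realType) (n : nat) (T : 'M[R]_n) (t : R) : 'M[R]_n :=
  afc (fun x => log_dd x t) T.

Definition lead_mx (R : realType) (n l : nat) (hl : (l <= n)%N) (A : 'M[R]_n) :
    'M[R]_l :=
  mxsub (widen_ord hl) (widen_ord hl) A.

(* Main.v *)
(** A triangular matrix P is treated through its leading block: with E_s(P) the
    corner block of exp [[P, I], [0, s I]], i.e. the divided difference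
    exp[., s](P), intertwining gives
      exp [[P, q], [0, s]] = [[exp P, E_s(P) q], [0, e^s]].
    E_s(P) is triangular with positive diagonal, so exp is a bijection from ut_n
    onto UT_n by induction on n, and the corner of log [[T, b], [0, t]] is
    E_{ln t}(log T)^-1 b.  This inverse is log^[1](T, t): perturbing log T to
    have distinct eigenvalues, log^[1](T, t) E_{ln t}(log T) commutes with T and
    has unit diagonal, hence is the identity.  The corner of the Karcher equation
    is then a linear system for y, whose matrix is triangular with positive
    diagonal; this gives existence, uniqueness and the recursion at once. *)

Require Import Defs.
From HB Require Import structures.
From mathcomp Require Import all_boot all_order all_algebra.
From mathcomp Require Import all_classical all_reals all_analysis.
From mathcomp Require Import lra ring.

Set Implicit Arguments.
Unset Strict Implicit.
Unset Printing Implicit Defensive.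

Import Order.TTheory GRing.Theory Num.Theory.
Import numFieldNormedType.Exports.

Local Open Scope ring_scope.

(** * Algebra of upper triangular matrices *)

Section UpperTriangular.
Variable R : realType.

(** One fact about power series carries the algebra: T W = W U with W rectangular implies f(T) W = W
    f(U). Commutation, leading blocks and corner formulas are all choices of W. The analytic
    obstacle is that [is_afc] only places the eigenvalues of T in the disc, while off-diagonal
    entries may be large. A diagonal rescaling makes them small, so a triangular matrix obeys the
    bounds of its diagonal. The same rescaling survives small perturbations, which gives continuity
    of f(T) by dominated convergence and justifies the passage to distinct eigenvalues. The
    perturbation acts on log T rather than T because exp and E_s are both continuous there.
    Existence of a disc for log^[1](., t) comes from an explicit power series, whose sum is
    identified by differentiating (x - t) log^[1](x, t). Since the block form of the Karcher
    equation is an equivalence, the recursion only requires restricting the equation for X' to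
    leading blocks. *)

Lemma upper_mxP (n : nat) (A : 'M[R]_n) :
  upper_mx A <-> forall i j : 'I_n, (j < i)%N -> A i j = 0.
Proof.
rewrite /upper_mx; split => [/is_trig_mxP h i j lji|h].
  by have := h _ _ lji; rewrite mxE.
by apply/is_trig_mxP => i j lij; rewrite mxE h.
Qed.

Lemma upper_scalar (n : nat) (c : R) : upper_mx (c%:M : 'M[R]_n).
Proof. by apply/upper_mxP => i j lji; rewrite mxE -val_eqE gtn_eqF. Qed.

Lemma upperD (n : nat) (A B : 'M[R]_n) :
  upper_mx A -> upper_mx B -> upper_mx (A + B).
Proof.
move=> /upper_mxP hA /upper_mxP hB; apply/upper_mxP => i j lji.
by rewrite mxE hA ?hB ?addr0.
Qed.

Lemma upperZ (n : nat) (c : R) (A : 'M[R]_n) : upper_mx A -> upper_mx (c *: A).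
Proof.
by move=> /upper_mxP hA; apply/upper_mxP => i j lji; rewrite mxE hA ?mulr0.
Qed.

Lemma upper_sum (n : nat) (I : finType) (A : I -> 'M[R]_n) :
  (forall i, upper_mx (A i)) -> upper_mx (\sum_i A i).
Proof.
move=> hA; apply/upper_mxP => i j lji; rewrite summxE big1 // => l _.
exact/(upper_mxP _).1.
Qed.

Lemma upperM (n : nat) (A B : 'M[R]_n) :
  upper_mx A -> upper_mx B -> upper_mx (A *m B).
Proof.
move=> /upper_mxP hA /upper_mxP hB; apply/upper_mxP => i j lji.
rewrite mxE big1 // => l _; have [lli|lil] := ltnP l i.
  by rewrite hA ?mul0r.
by rewrite hB ?mulr0 // (leq_trans lji).
Qed.

Lemma upperM_diag (n : nat) (A B : 'M[R]_n) (i : 'I_n) :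
  upper_mx A -> upper_mx B -> (A *m B) i i = A i i * B i i.
Proof.
move=> /upper_mxP hA /upper_mxP hB.
rewrite mxE (bigD1 i) //= big1 ?addr0 // => l /negP nli.
have [lli|lil|/val_inj eli] := ltngtP l i; last by case: nli; apply/eqP.
  by rewrite hA ?mul0r.
by rewrite hB ?mulr0.
Qed.

Lemma upperX (n : nat) (A : 'M[R]_n) (k : nat) : upper_mx A -> upper_mx (A ^+ k).
Proof.
move=> hA; elim: k => [|k ih]; first by rewrite expr0; exact: upper_scalar.
by rewrite exprS; exact: upperM.
Qed.

Lemma upperX_diag (n : nat) (A : 'M[R]_n) (k : nat) (i : 'I_n) :
  upper_mx A -> (A ^+ k) i i = A i i ^+ k.
Proof.
move=> hA; elim: k => [|k ih]; first by rewrite !expr0 mxE eqxx.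
by rewrite !exprS upperM_diag ?ih //; exact: upperX.
Qed.

Lemma upper_block (n p : nat) (A : 'M[R]_n) (B : 'M[R]_(n, p)) (D : 'M[R]_p) :
  upper_mx (block_mx A B 0 D) <-> upper_mx A /\ upper_mx D.
Proof.
rewrite /upper_mx tr_block_mx trmx0 is_trig_block_mx // eqxx /=.
by split => [/andP|[-> ->]].
Qed.

Lemma upper_blockP (n p : nat) (A : 'M[R]_(n + p)) : upper_mx A ->
  A = block_mx (ulsubmx A) (ursubmx A) 0 (drsubmx A).
Proof.
move=> hA; rewrite -[LHS]submxK; congr block_mx.
rewrite -[RHS]trmx0 -[LHS]trmxK; congr (_^T).
by rewrite trmx_dlsub; exact: ursubmx_trig.
Qed.

Lemma upper_unit (n : nat) (A : 'M[R]_n) :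
  upper_mx A -> (forall i, A i i != 0) -> A \in unitmx.
Proof.
move=> hA nz; rewrite unitmxE -det_tr det_trig // unitfE.
by apply/prodf_neq0 => i _; rewrite mxE.
Qed.

Lemma upper_inv (n : nat) (A : 'M[R]_n) :
  upper_mx A -> (forall i, A i i != 0) -> upper_mx (invmx A).
Proof.
elim: n A => [|n IH] A; first by move=> _ _; apply/upper_mxP => -[].
move: A; rewrite -addn1 => A hA.
move: (ulsubmx A) (ursubmx A) (drsubmx A) (upper_blockP hA) => P q s eA.
move: hA; rewrite eA => hA nz; have uA := upper_unit hA nz.
have [hP hs] := (upper_block _ _ _).1 hA.
have nzP i : P i i != 0.
  by have := nz (lshift _ i); rewrite block_mxEul.
have nzs i : s i i != 0.
  by have := nz (rshift _ i); rewrite block_mxEdr.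
have uP := upper_unit hP nzP; have us := upper_unit hs nzs.
suff -> : invmx (block_mx P q 0 s) =
    block_mx (invmx P) (- (invmx P *m q *m invmx s)) 0 (invmx s).
  by apply/upper_block; split; [exact: IH|apply/upper_mxP => i j; rewrite !ord1].
apply: (can_inj (mulKmx uA)); rewrite mulmxV // mulmx_block !mulmx0 !mul0mx.
rewrite !(mulmxV uP, mulmxV us) !add0r !addr0 mulmxN -!mulmxA mulKVmx //.
by rewrite addNr -scalar_mx_block.
Qed.

Lemma upper_inv_diag (n : nat) (A : 'M[R]_n) (i : 'I_n) :
  upper_mx A -> (forall i, A i i != 0) -> (invmx A) i i = (A i i)^-1.
Proof.
move=> hA nz; apply: (mulfI (nz i)); rewrite divff // -upperM_diag //.
  by rewrite mulmxV ?mxE ?eqxx //; exact: upper_unit.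
exact: upper_inv.
Qed.

(* The entries of the difference vanish one superdiagonal after the other. *)
Lemma upper_comm_eq (n : nat) (T Y Z : 'M[R]_n) :
  upper_mx T -> upper_mx Y -> upper_mx Z ->
  (forall i j, i != j -> T i i != T j j) ->
  Y *m T = T *m Y -> Z *m T = T *m Z -> (forall i, Y i i = Z i i) -> Y = Z.
Proof.
move=> hT hY hZ dT cY cZ dYZ; apply/subr0_eq; set W := Y - Z.
have hW : upper_mx W.
  by apply: upperD => //; rewrite -scaleN1r; exact: upperZ.
have dW i : W i i = 0 by rewrite !mxE dYZ subrr.
have cW : W *m T = T *m W by rewrite mulmxBl mulmxBr cY cZ.
clearbody W.
move/upper_mxP: hT => hT; move/upper_mxP: hW => hW.
suff main d (i j : 'I_n) : (j < i + d)%N -> W i j = 0.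
  apply/matrixP => i j; rewrite [RHS]mxE; apply: (main n).
  exact: leq_trans (ltn_ord j) (leq_addl _ _).
elim: d i j => [|d IH] i j; first by rewrite addn0; exact: hW.
rewrite addnS ltnS leq_eqVlt => /predU1P[ej|]; last exact: IH.
have [/eqP eij|nij] := boolP (i == j); first by rewrite eij.
have := congr1 (fun M : 'M[R]_n => M i j) cW; rewrite !mxE.
rewrite (bigD1 j) //= big1 ?addr0; last first.
  move=> l /negP nl; have [llj|ljl|/val_inj e] := ltngtP l j.
  - by rewrite IH ?mul0r // -ej.
  - by rewrite hT ?mulr0.
  - by case: nl; apply/eqP.
rewrite (bigD1 i) //= big1 ?addr0; last first.
  move=> l /negP nl; have [lli|lil|/val_inj e] := ltngtP l i.
  - by rewrite hT ?mul0r.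
  - by rewrite [W _ _]IH ?mulr0 // ej ltn_add2r.
  - by case: nl; apply/eqP.
(* Only l = j on the left and l = i on the right survive: the (i, j) entry reads
   [(T j j - T i i) * W i j = 0]. *)
move=> /eqP; rewrite mulrC -subr_eq0 -mulrBl mulf_eq0 subr_eq0.
by rewrite eq_sym (negbTE (dT _ _ nij)) => /eqP.
Qed.

Lemma upper_eigenvalueP (n : nat) (A : 'M[R]_n) (l : R) :
  upper_mx A -> eigenvalue A l <-> exists i, A i i = l.
Proof.
move=> hA; rewrite eigenvalue_root_char.
have -> : char_poly A = char_poly A^T.
  rewrite /char_poly -det_tr; congr (\det _).
  apply/matrixP => i j; rewrite !mxE eq_sym.
  by have [//|_] := eqVneq i j.
rewrite char_poly_trig // rootE horner_prod.
split=> [/prodf_eq0[i _]|[i <-]].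
  by rewrite !mxE hornerXsubC subr_eq0 => /eqP ->; exists i.
by apply/prodf_eq0; exists i => //; rewrite !mxE hornerXsubC subrr.
Qed.

End UpperTriangular.

(** * Power series of triangular matrices: convergence, intertwining, continuity *)

Section MatrixPowerSeries.
Local Open Scope classical_set_scope.
Variable R : realType.

Lemma cvg_mxP (T : Type) (F : set_system T) (FF : Filter F) (m n : nat)
    (f : T -> 'M[R]_(m, n)) (M : 'M[R]_(m, n)) :
  f @ F --> M <-> forall i j, (fun t => f t i j) @ F --> M i j.
Proof.
split=> [fM i j|fM]; last first.
  move=> A [P nP sPA]; rewrite /fmap /=.
  have : \forall t \near F, forall i, forall j, P i j (f t i j).
    apply: filter_forall => i; apply: filter_forall => j.
    exact: fM i j _ (nP i j).
  by apply: filterS => t Pt; apply: sPA.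
move=> A nA; apply: (fM [set N : 'M[R]_(m, n) | A (N i j)]).
(* A basic neighbourhood that constrains the entry (i, j) alone; at every other index the
   implication is vacuous. *)
exists (fun k l => [set x | (k = i /\ l = j) -> A x]); last first.
  by move=> N /(_ i j) h; apply: h; split.
move=> k l; have [[-> ->]|ne] := pselect (k = i /\ l = j).
  by apply: filterS nA => x Ax _.
by apply: filterS filterT => x _ /ne.
Qed.

Lemma cvg_mx_unique (T : Type) (F : set_system T) (FF : ProperFilter F)
    (m n : nat) (f : T -> 'M[R]_(m, n)) (M N : 'M[R]_(m, n)) :
  f @ F --> M -> f @ F --> N -> M = N.
Proof.
move=> /cvg_mxP fM /cvg_mxP fN; apply/matrixP => i j.
exact: (cvg_unique _ (fM i j) (fN i j)).
Qed.

Lemma cvg_mx_lim (m n : nat) (f : nat -> 'M[R]_(m, n)) (M : 'M[R]_(m, n)) :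
  f @ \oo --> M -> limn f = M.
Proof.
move=> fM; apply: (@cvg_mx_unique _ \oo _ _ _ f) => //.
by apply/cvg_ex; exists M.
Qed.

Lemma cvg_bigsum (T I : Type) (F : set_system T) (FF : Filter F) (r : seq I)
    (f : T -> I -> R) (l : I -> R) :
  (forall i, f^~ i @ F --> l i) ->
  (fun t => \sum_(i <- r) f t i) @ F --> \sum_(i <- r) l i.
Proof.
move=> fl; elim: r => [|i r IH].
  by under eq_fun do rewrite big_nil; rewrite big_nil; exact: cvg_cst.
by under eq_fun do rewrite big_cons; rewrite big_cons; exact: cvgD.
Qed.

Lemma cvg_seriesMl (c : R) (f : R ^nat) : cvgn (series f) ->
  series (fun k => c * f k) @ \oo --> c * limn (series f).
Proof.
move=> cf; rewrite (_ : series _ = fun N => c * series f N).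
  by apply: cvgM cf; exact: cvg_cst.
by apply/funext => N; rewrite /series /= mulr_sumr.
Qed.

(** Weierstrass test with an explicit tail. At [N = 0] the partial sums vanish, so it also serves as
    comparison test and as a bound on the whole sum. *)
Lemma series_tail_le (f M : R ^nat) (N : nat) :
  (forall k, `|f k| <= M k) -> cvgn (series M) ->
  cvgn (series f) /\
  `|limn (series f) - series f N| <= limn (series M) - series M N.
Proof.
move=> fM cM.
have cf : cvgn (series f).
  apply: normed_cvg; apply: (series_le_cvg _ _ fM cM) => n.
    exact: normr_ge0.
  exact: le_trans (fM n).
split=> //.
have c1 : (fun n => `|series f n - series f N|) @ \oo -->
    `|limn (series f) - series f N|.
  by apply: cvg_norm; apply: cvgB => //; exact: cvg_cst.
have c2 : (fun n => series M n - series M N) @ \oo -->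
    limn (series M) - series M N.
  by apply: cvgB => //; exact: cvg_cst.
apply: ler_cvg_to c1 c2 _; near=> n.
have Nn : (N <= n)%N by near: n; exact: nbhs_infty_ge.
rewrite !sub_series_geq //; apply: le_trans (ler_norm_sum _ _ _) _.
exact: ler_sum.
Unshelve. all: by end_near. Qed.

(** Dominated convergence for series: beyond N both tails are bounded by the tail of M, and the head
    is a finite sum of convergent terms. Each of the three errors gets e / 3. *)
Lemma tannery (f : nat -> R ^nat) (g M : R ^nat) :
  cvgn (series M) -> (\forall j \near \oo, forall k, `|f j k| <= M k) ->
  (forall k, f^~ k @ \oo --> g k) ->
  (fun j => limn (series (f j))) @ \oo --> limn (series g).
Proof.
move=> cM fM fg.
have gM k : `|g k| <= M k.
  have c1 : (fun j => `|f j k|) @ \oo --> `|g k| by exact: cvg_norm.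
  have c2 : (fun j : nat => M k) @ \oo --> M k by exact: cvg_cst.
  by apply: ler_cvg_to c1 c2 _; apply: filterS fM => j; apply.
apply/cvgrPdist_lt => e e0; have e3 : 0 < e / 3 by rewrite divr_gt0.
have [N _ /(_ N (leqnn N)) hN] := ((cvgrPdist_lt _ _).1 cM) _ e3.
have hN' : limn (series M) - series M N < e / 3.
  exact: le_lt_trans (ler_norm _) hN.
have cN : (fun j => series (f j) N) @ \oo --> series g N.
  rewrite /series /=; apply: cvg_bigsum => k; exact: fg.
near=> j.
have fMj : forall k, `|f j k| <= M k by near: j.
have [_ h1] := series_tail_le N fMj cM.
have [_ h2] := series_tail_le N gM cM.
have h3 : `|series g N - series (f j) N| < e / 3.
  by near: j; exact: ((cvgrPdist_lt _ _).1 cN).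
have -> : limn (series g) - limn (series (f j)) =
  (limn (series g) - series g N) + (series g N - series (f j) N)
    - (limn (series (f j)) - series (f j) N) by ring.
apply: le_lt_trans (ler_normB _ _) _.
apply: le_lt_trans (lerD (ler_normD _ _) (lexx _)) _.
lra.
Unshelve. all: by end_near. Qed.

Definition mxpser (n : nat) (a : R ^nat) (T : 'M[R]_n) : 'M[R]_n :=
  limn (series (fun k => a k *: T ^+ k)).

(** Asked at the radius [rho] itself, so that [|a k| * rho ^+ k] is directly a summable majorant for
    matrices whose diagonal lies strictly inside [rho]. *)
Definition abs_cvg (a : R ^nat) (rho : R) : Prop :=
  0 < rho /\ cvgn (series (fun k => `|a k| * rho ^+ k)).

(* The weighted row sums bound T in an operator norm, hence also its powers. *)
Definition row_bound (n : nat) (v : 'I_n -> R) (rho : R) (T : 'M[R]_n) : Prop :=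
  forall i, \sum_j `|T i j| * v j < rho * v i.

Lemma row_bound_exp (n : nat) (v : 'I_n -> R) (rho : R) (T : 'M[R]_n)
    (k : nat) (i j : 'I_n) :
  (forall i, 0 < v i) -> 0 < rho -> row_bound v rho T ->
  `|(T ^+ k) i j| <= rho ^+ k * (v i / v j).
Proof.
move=> v0 r0 hT; rewrite mulrA ler_pdivlMr //.
have vge l : 0 <= v l by exact: ltW.
(* The induction carries the whole weighted row sum; a single entry is one nonnegative term of
   it. *)
suff H l : \sum_p `|(T ^+ k) l p| * v p <= rho ^+ k * v l.
  apply: le_trans (H i); rewrite (bigD1 j) //= lerDl.
  by apply: sumr_ge0 => p _; rewrite mulr_ge0.
elim: k l => [|k IH] l.
  rewrite expr0 mul1r (bigD1 l) //= big1 ?addr0; last first.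
    by move=> p /negPf nl; rewrite mxE eq_sym nl normr0 mul0r.
  by rewrite mxE eqxx normr1 mul1r.
apply: le_trans (_ : \sum_p \sum_q `|T l q| * (`|(T ^+ k) q p| * v p) <= _).
  apply: ler_sum => p _; rewrite exprS mxE.
  under [leRHS]eq_bigr do rewrite mulrA; rewrite -mulr_suml ler_wpM2r //.
  apply: le_trans (ler_norm_sum _ _ _) _.
  by apply: ler_sum => q _; rewrite normrM.
rewrite exchange_big /=.
apply: le_trans (_ : \sum_q `|T l q| * (rho ^+ k * v q) <= _).
  by apply: ler_sum => q _; rewrite -mulr_sumr ler_wpM2l.
under eq_bigr do rewrite mulrCA.
by rewrite -mulr_sumr exprSr -mulrA ler_wpM2l ?exprn_ge0 // ltW.
Qed.

(** Conjugation by diag(e^i) multiplies the (i, j) entry by e^(j - i), so a small e shrinks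
    everything above the diagonal. Here g is the gap between [rho] and the diagonal, S the sum of
    all absolute entries, and e is chosen with e S < g; [e <= 1] replaces each e^(j - i) with j > i
    by e. *)
Lemma upper_row_bound (n : nat) (rho : R) (T : 'M[R]_n) :
  upper_mx T -> (forall i, `|T i i| < rho) ->
  exists2 v : 'I_n -> R, (forall i, 0 < v i) & row_bound v rho T.
Proof.
move=> /upper_mxP hT dT.
have [g g0 hg] : exists2 g, 0 < g & forall i, `|T i i| + g <= rho.
  exists (\big[Num.min/1]_i (rho - `|T i i|)).
    by apply: lt_bigmin => // i _; rewrite subr_gt0.
  by move=> i; rewrite -lerBrDl; exact: bigmin_le.
pose S := \sum_i \sum_j `|T i j|.
have S0 : 0 <= S by apply: sumr_ge0 => i _; exact: sumr_ge0.
pose e := Num.min 1 (g / (S + 1)).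
have S10 : 0 < S + 1 by rewrite ltr_wpDl.
have e0 : 0 < e by rewrite lt_min ltr01 divr_gt0.
have e1 : e <= 1 by rewrite ge_min lexx.
have eS : e * S < g.
  apply: lt_le_trans (_ : e * (S + 1) <= _); first by rewrite ltr_pM2l // ltrDl.
  by rewrite -ler_pdivlMr // ge_min lexx orbT.
exists (fun i => e ^+ i) => [i|i]; first exact: exprn_gt0.
rewrite (bigD1 i) //=.
have -> : rho * e ^+ i = `|T i i| * e ^+ i + (rho - `|T i i|) * e ^+ i by ring.
rewrite ltrD2l.
apply: le_lt_trans (_ : \sum_(j | j != i) `|T i j| * (e * e ^+ i) < _).
  apply: ler_sum => j; rewrite neq_ltn => /orP[lji|lij].
    by rewrite hT // normr0 !mul0r.
  rewrite ler_wpM2l // -exprS -(subnK lij) exprD ler_piMl //.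
    by rewrite exprn_ge0 // ltW.
  by rewrite exprn_ile1 // ltW.
rewrite -mulr_suml mulrA ltr_pM2r ?exprn_gt0 //.
apply: le_lt_trans (_ : S * e < _); last first.
  by rewrite mulrC; apply: lt_le_trans eS _; rewrite lerBrDl.
rewrite ler_pM2r // /S [leRHS](bigD1 i) //= [X in _ <= X + _](bigD1 i) //=.
rewrite [X in _ <= X + _]addrC -addrA lerDl addr_ge0 ?sumr_ge0 // => l _.
exact: sumr_ge0.
Qed.

Lemma mxpser_entry_cvg (n : nat) (a : R ^nat) (rho : R) (T : 'M[R]_n)
    (i j : 'I_n) :
  abs_cvg a rho -> upper_mx T -> (forall l, `|T l l| < rho) ->
  cvgn (series (fun k => a k * (T ^+ k) i j)).
Proof.
move=> [r0 ca] hT dT; have [v v0 hv] := upper_row_bound hT dT.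
have cM : cvgn (series (fun k => v i / v j * (`|a k| * rho ^+ k))).
  apply/cvg_ex; eexists; exact: cvg_seriesMl ca.
apply: (series_tail_le 0 _ cM).1 => k.
rewrite normrM mulrCA ler_wpM2l // mulrC; exact: row_bound_exp.
Qed.

Lemma series_mxE (n : nat) (a : R ^nat) (T : 'M[R]_n) (N : nat) (i j : 'I_n) :
  series (fun k => a k *: T ^+ k) N i j = series (fun k => a k * (T ^+ k) i j) N.
Proof. by rewrite /series /= summxE; apply: eq_bigr => k _; rewrite mxE. Qed.

Lemma mxpser_cvg (n : nat) (a : R ^nat) (rho : R) (T : 'M[R]_n) :
  abs_cvg a rho -> upper_mx T -> (forall l, `|T l l| < rho) ->
  series (fun k => a k *: T ^+ k) @ \oo --> mxpser a T.
Proof.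
move=> ha hT dT.
pose B := \matrix_(i, j) limn (series (fun k => a k * (T ^+ k) i j)).
have cB : series (fun k => a k *: T ^+ k) @ \oo --> B.
  apply/cvg_mxP => i j; under eq_fun do rewrite series_mxE.
  rewrite mxE; exact: mxpser_entry_cvg ha hT dT.
by rewrite /mxpser (cvg_mx_lim cB).
Qed.

Lemma mxpserE (n : nat) (a : R ^nat) (rho : R) (T : 'M[R]_n) (i j : 'I_n) :
  abs_cvg a rho -> upper_mx T -> (forall l, `|T l l| < rho) ->
  mxpser a T i j = limn (series (fun k => a k * (T ^+ k) i j)).
Proof.
move=> ha hT dT; have /cvg_mxP/(_ i j) := mxpser_cvg ha hT dT.
under eq_fun do rewrite series_mxE.
by move/cvg_lim => <-.
Qed.

Lemma mxpser_upper (n : nat) (a : R ^nat) (rho : R) (T : 'M[R]_n) :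
  abs_cvg a rho -> upper_mx T -> (forall l, `|T l l| < rho) ->
  upper_mx (mxpser a T).
Proof.
move=> ha hT dT; apply/upper_mxP => i j lji.
rewrite (mxpserE _ _ ha hT dT).
under eq_fun => k do rewrite ((upper_mxP _).1 (upperX k hT) _ _ lji) mulr0.
rewrite (_ : series _ = fun=> 0) ?lim_cst //.
by apply/funext => k; rewrite /series /= big1.
Qed.

Lemma mxpser_diag (n : nat) (a : R ^nat) (rho : R) (T : 'M[R]_n) (i : 'I_n) :
  abs_cvg a rho -> upper_mx T -> (forall l, `|T l l| < rho) ->
  mxpser a T i i = limn (pseries a (T i i)).
Proof.
move=> ha hT dT; rewrite (mxpserE _ _ ha hT dT).
by under eq_fun => k do rewrite (upperX_diag k i hT).
Qed.

(** T^k W = W U^k for every k, and both sides converge entrywise. W is rectangular so that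
    inclusions and projections of blocks qualify. *)
Lemma mxpser_intertwine (m n : nat) (a : R ^nat) (rho : R) (T : 'M[R]_m)
    (U : 'M[R]_n) (W : 'M[R]_(m, n)) :
  abs_cvg a rho -> upper_mx T -> (forall l, `|T l l| < rho) ->
  upper_mx U -> (forall l, `|U l l| < rho) ->
  T *m W = W *m U -> mxpser a T *m W = W *m mxpser a U.
Proof.
move=> ha hT dT hU dU TW.
have cT := mxpser_cvg ha hT dT; have cU := mxpser_cvg ha hU dU.
have TWk k : T ^+ k *m W = W *m U ^+ k.
  elim: k => [|k IH]; first by rewrite !expr0 mul1mx mulmx1.
  rewrite exprS exprSr -mulmxA IH mulmxA TW -mulmxA.
  by rewrite -[U *m _]/(U * _) -exprS exprSr.
have eqs N : series (fun k => a k *: T ^+ k) N *m W =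
    W *m series (fun k => a k *: U ^+ k) N.
  rewrite /series /= mulmx_suml mulmx_sumr; apply: eq_bigr => k _.
  by rewrite -scalemxAl TWk scalemxAr.
apply: (@cvg_mx_unique _ \oo _ _ _
  (fun N => series (fun k => a k *: T ^+ k) N *m W)).
  apply/cvg_mxP => i j; under eq_fun do rewrite mxE.
  rewrite mxE; apply: cvg_bigsum => l; apply: cvgM; last exact: cvg_cst.
  by move/cvg_mxP: cT; apply.
under eq_fun do rewrite eqs.
apply/cvg_mxP => i j; under eq_fun do rewrite mxE.
rewrite mxE; apply: cvg_bigsum => l; apply: cvgM; first exact: cvg_cst.
by move/cvg_mxP: cU; apply.
Qed.

Lemma mxpser_continuous (n : nat) (a : R ^nat) (rho : R) (u : nat -> 'M[R]_n)
    (T : 'M[R]_n) :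
  abs_cvg a rho -> (forall j, upper_mx (u j)) -> upper_mx T ->
  (forall l, `|T l l| < rho) ->
  u @ \oo --> T -> (fun j => mxpser a (u j)) @ \oo --> mxpser a T.
Proof.
move=> ha hu hT dT uT; have [r0 ca] := ha.
have [v v0 hv] := upper_row_bound hT dT.
have uTe i j : (fun k => u k i j) @ \oo --> T i j by move/cvg_mxP: uT; apply.
(* The strict inequality in [row_bound] is an open condition, so the weights found for the limit T
   work for all late terms and supply one common majorant. *)
have near_bound : \forall k \near \oo, row_bound v rho (u k).
  apply: filter_forall => i.
  have c : (fun k => \sum_j `|u k i j| * v j) @ \oo --> \sum_j `|T i j| * v j.
    apply: cvg_bigsum => j; apply: cvgM; last exact: cvg_cst.
    exact: cvg_norm.
  exact: cvgr_lt c _ (hv i).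
have near_diag : \forall k \near \oo, forall l, `|u k l l| < rho.
  apply: filter_forall => l.
  by apply: cvgr_lt (dT l); exact: cvg_norm.
apply/cvg_mxP => i j; rewrite (mxpserE _ _ ha hT dT).
have near_eq : \forall k \near \oo,
    limn (series (fun p => a p * ((u k) ^+ p) i j)) = mxpser a (u k) i j.
  by apply: filterS near_diag => k dk; rewrite (mxpserE _ _ ha (hu k) dk).
apply: cvg_trans (near_eq_cvg near_eq) _.
have cM : cvgn (series (fun k => v i / v j * (`|a k| * rho ^+ k))).
  apply/cvg_ex; eexists; exact: cvg_seriesMl ca.
apply: tannery cM _ _.
  apply: filterS near_bound => k bk p.
  rewrite normrM mulrCA ler_wpM2l // mulrC; exact: row_bound_exp.
move=> p; apply: cvgM; first exact: cvg_cst.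
elim: p i j {near_eq} => [|p IH] i j.
  by under eq_fun do rewrite expr0; rewrite expr0; exact: cvg_cst.
under eq_fun do rewrite exprS mxE.
by rewrite exprS mxE; apply: cvg_bigsum => l; exact: cvgM.
Qed.

End MatrixPowerSeries.

(** * The exponential and its divided differences *)

Section TriangularExponential.
Local Open Scope classical_set_scope.
Variable R : realType.

Let inv_fact : R ^nat := fun k => (k`!%:R)^-1.

Lemma abs_cvg_inv_fact (rho : R) : 0 < rho -> abs_cvg inv_fact rho.
Proof.
move=> r0; split=> //.
rewrite (_ : (fun k => _) = exp_coeff rho); first exact: is_cvg_series_exp_coeff.
by apply/funext => k; rewrite /exp_coeff /= ger0_norm ?invr_ge0 // mulrC.
Qed.

Lemma diag_bounded (n : nat) (T : 'M[R]_n) :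
  exists2 rho : R, 0 < rho & forall l, `|T l l| < rho.
Proof.
exists (1 + \sum_l `|T l l|); first by rewrite ltr_pwDl ?sumr_ge0.
by move=> l; rewrite (bigD1 l) //= addrCA ltrDl ltr_pwDl ?sumr_ge0.
Qed.

Lemma expm_cvg (n : nat) (L : 'M[R]_n) : upper_mx L ->
  series (fun k => inv_fact k *: L ^+ k) @ \oo --> expm L.
Proof.
move=> hL; have [rho r0 dL] := diag_bounded L.
exact: mxpser_cvg (abs_cvg_inv_fact r0) hL dL.
Qed.

Lemma expm_upper (n : nat) (L : 'M[R]_n) : upper_mx L -> upper_mx (expm L).
Proof.
move=> hL; have [rho r0 dL] := diag_bounded L.
exact: mxpser_upper (abs_cvg_inv_fact r0) hL dL.
Qed.

Lemma expm_diag (n : nat) (L : 'M[R]_n) (i : 'I_n) :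
  upper_mx L -> expm L i i = expR (L i i).
Proof.
move=> hL; have [rho r0 dL] := diag_bounded L; rewrite expRE.
exact: mxpser_diag (abs_cvg_inv_fact r0) hL dL.
Qed.

Lemma expm_intertwine (m n : nat) (T : 'M[R]_m) (U : 'M[R]_n) (W : 'M[R]_(m, n)) :
  upper_mx T -> upper_mx U -> T *m W = W *m U -> expm T *m W = W *m expm U.
Proof.
move=> hT hU; have [r r0 dT] := diag_bounded T; have [r' r0' dU] := diag_bounded U.
have rr0 : 0 < r + r' by exact: addr_gt0.
apply: mxpser_intertwine (abs_cvg_inv_fact rr0) hT _ hU _ => l.
  by apply: lt_le_trans (dT l) _; rewrite lerDl ltW.
by apply: lt_le_trans (dU l) _; rewrite lerDr ltW.
Qed.

Lemma expm_continuous (n : nat) (u : nat -> 'M[R]_n) (L : 'M[R]_n) :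
  (forall j, upper_mx (u j)) -> upper_mx L -> u @ \oo --> L ->
  (fun j => expm (u j)) @ \oo --> expm L.
Proof.
move=> hu hL uL; have [r r0 dL] := diag_bounded L.
exact: mxpser_continuous (abs_cvg_inv_fact r0) hu hL dL uL.
Qed.

Lemma UT_expm (n : nat) (L : 'M[R]_n) : upper_mx L -> UT (expm L).
Proof.
by move=> hL; split=> [|i]; [exact: expm_upper|rewrite expm_diag ?expR_gt0].
Qed.

(** The j-th basis vector intertwines the scalar matrix with the 1 by 1 matrix s, whose exponential
    is known from its diagonal. *)
Lemma expm_scalar (n : nat) (s : R) : expm (s%:M : 'M[R]_n) = (expR s)%:M.
Proof.
apply/matrixP => i j; pose W : 'cV[R]_n := delta_mx j 0.
have : expm (s%:M : 'M[R]_n) *m W = W *m expm (s%:M : 'M[R]_1).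
  by apply: expm_intertwine; [exact: upper_scalar..|rewrite scalar_mxC].
rewrite [expm (s%:M : 'M[R]_1)]mx11_scalar expm_diag; last exact: upper_scalar.
rewrite mul_mx_scalar -colE => /matrixP/(_ i 0); rewrite !mxE eqxx andbT => ->.
by rewrite mulr_natr mulr1n.
Qed.

Lemma expm_comm (n : nat) (L W : 'M[R]_n) :
  upper_mx L -> L *m W = W *m L -> expm L *m W = W *m expm L.
Proof. by move=> hL; exact: expm_intertwine. Qed.

Lemma lead_mx_upper (n l : nat) (hl : (l <= n)%N) (A : 'M[R]_n) :
  upper_mx A -> upper_mx (lead_mx hl A).
Proof.
by move=> /upper_mxP hA; apply/upper_mxP => i j lji; rewrite mxE hA.
Qed.

(* [colsub _ 1%:M] is the inclusion of the first l coordinates, an invariant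
   subspace of A. *)
Lemma lead_mx_intertwine (n l : nat) (hl : (l <= n)%N) (A : 'M[R]_n) :
  upper_mx A ->
  A *m colsub (widen_ord hl) 1%:M = colsub (widen_ord hl) 1%:M *m lead_mx hl A.
Proof.
move=> /upper_mxP hA; rewrite mulmx_colsub mulmx1; apply/matrixP => i j.
rewrite !mxE; have [il|li] := ltnP i l.
  have -> : i = widen_ord hl (Ordinal il) by apply: val_inj.
  rewrite (bigD1 (Ordinal il)) //= !mxE eqxx mul1r big1 ?addr0 // => k nk.
  rewrite -val_eqE /= in nk.
  by rewrite !mxE -val_eqE /= eq_sym (negbTE nk) mul0r.
rewrite hA ?(leq_trans (ltn_ord j)) // big1 // => k _.
by rewrite !mxE -val_eqE /= gtn_eqF ?mul0r ?(leq_trans (ltn_ord k)).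
Qed.

Lemma lead_mxE (n l : nat) (hl : (l <= n)%N) (A : 'M[R]_n) :
  lead_mx hl A = rowsub (widen_ord hl) (A *m colsub (widen_ord hl) 1%:M).
Proof. by rewrite mulmx_colsub mulmx1; apply/matrixP => i j; rewrite !mxE. Qed.

Lemma lead_mxK (n l p : nat) (hl : (l <= n)%N) (B : 'M[R]_(l, p)) :
  rowsub (widen_ord hl) (colsub (widen_ord hl) 1%:M *m B) = B.
Proof.
rewrite -mul_rowsub_mx -[RHS]mul1mx; congr mulmx.
by apply/matrixP => i j; rewrite !mxE -val_eqE.
Qed.

Lemma lead_mxM (n l : nat) (hl : (l <= n)%N) (A B : 'M[R]_n) :
  upper_mx B -> lead_mx hl (A *m B) = lead_mx hl A *m lead_mx hl B.
Proof.
move=> hB; rewrite lead_mxE -mulmxA lead_mx_intertwine // mulmxA.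
by rewrite -mul_rowsub_mx -lead_mxE.
Qed.

Lemma lead_expm (n l : nat) (hl : (l <= n)%N) (L : 'M[R]_n) :
  upper_mx L -> lead_mx hl (expm L) = expm (lead_mx hl L).
Proof.
move=> hL; rewrite lead_mxE.
rewrite (expm_intertwine hL (lead_mx_upper hl hL) (lead_mx_intertwine hl hL)).
exact: lead_mxK.
Qed.

(* The matrix of divided differences exp[., s](P), as the corner block of an
   exponential. *)
Definition exp_dd (n : nat) (P : 'M[R]_n) (s : R) : 'M[R]_n :=
  ursubmx (expm (block_mx P 1%:M 0 s%:M)).

Lemma upper_dd_block (n : nat) (P : 'M[R]_n) (s : R) :
  upper_mx P -> upper_mx (block_mx P 1%:M 0 (s%:M : 'M[R]_n)).
Proof. by move=> hP; apply/upper_block; split=> //; exact: upper_scalar. Qed.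

(** Inclusion of the first block intertwines the block matrix with P, projection onto the second
    with S; together they fix three of the four blocks. *)
Lemma expm_block_ur (n p : nat) (P : 'M[R]_n) (Q : 'M[R]_(n, p)) (S : 'M[R]_p) :
  upper_mx P -> upper_mx S ->
  expm (block_mx P Q 0 S) =
  block_mx (expm P) (ursubmx (expm (block_mx P Q 0 S))) 0 (expm S).
Proof.
move=> hP hS; set M := block_mx P Q 0 S.
have hM : upper_mx M by apply/upper_block.
have hl : M *m col_mx 1%:M 0 = col_mx 1%:M 0 *m P.
  by rewrite /M mul_block_col mul_col_mx !mulmx0 !mulmx1 mul1mx !mul0mx !addr0.
have hr : S *m row_mx 0 1%:M = row_mx 0 1%:M *m M.
  by rewrite /M mul_row_block mul_mx_row !mulmx0 !mulmx1 !mul1mx !mul0mx !add0r.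
have := expm_intertwine hM hP hl; have := expm_intertwine hS hM hr.
move: (expm M) => E; rewrite -[E]submxK block_mxKur mul_mx_row mul_row_block.
rewrite !mulmx0 mulmx1 !mul0mx !mul1mx !add0r => /eq_row_mx[<- <-].
rewrite mul_block_col mul_col_mx !mulmx0 !mulmx1 mul1mx mul0mx !addr0.
by move=> /eq_col_mx[-> _].
Qed.

Lemma expm_block (n p : nat) (P : 'M[R]_n) (Q : 'M[R]_(n, p)) (s : R) :
  upper_mx P ->
  expm (block_mx P Q 0 s%:M) = block_mx (expm P) (exp_dd P s *m Q) 0 (expR s)%:M.
Proof.
move=> hP; have hs k : upper_mx (s%:M : 'M[R]_k) by exact: upper_scalar.
rewrite expm_block_ur // expm_scalar; congr (block_mx _ _ 0 _).
(* diag(1, Q) intertwines the block matrix of corner 1 with that of corner Q; comparing top right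
   blocks shows the dependence on Q. *)
pose W : 'M[R]_(n + n, n + p) := block_mx 1%:M 0 0 Q.
have hW : block_mx P 1%:M 0 s%:M *m W = W *m block_mx P Q 0 s%:M.
  rewrite !mulmx_block !mulmx0 !mul0mx !mulmx1 !mul1mx !addr0 !add0r.
  by rewrite scalar_mxC.
have h1 : upper_mx (block_mx P Q 0 s%:M) by apply/upper_block.
have := expm_intertwine (upper_dd_block s hP) h1 hW.
rewrite (expm_block_ur 1%:M hP (hs n)) (expm_block_ur Q hP (hs p)).
rewrite -/(exp_dd P s) !mulmx_block !mulmx0 !mul0mx !mulmx1 !mul1mx !addr0 !add0r.
by rewrite block_mxKur => /eq_block_mx[_ -> _ _].
Qed.

Lemma exp_dd_comm (n : nat) (P W : 'M[R]_n) (s : R) :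
  upper_mx P -> P *m W = W *m P -> exp_dd P s *m W = W *m exp_dd P s.
Proof.
move=> hP PW; have hM := upper_dd_block s hP.
have : block_mx P 1%:M 0 s%:M *m block_mx W 0 0 W =
       block_mx W 0 0 W *m block_mx P 1%:M 0 s%:M.
  by rewrite !mulmx_block !mulmx0 !mul0mx mulmx1 mul1mx !addr0 !add0r PW scalar_mxC.
move=> /(expm_comm hM); rewrite (expm_block _ _ hP) mulmx1 !mulmx_block.
by rewrite !mulmx0 !mul0mx !addr0 !add0r => /eq_block_mx[].
Qed.

(** This is (P - s) E_s(P) = exp P - e^s, read in the corner of the fact that the block matrix
    commutes with its exponential. *)
Lemma exp_dd_mul (n : nat) (P : 'M[R]_n) (s : R) : upper_mx P ->
  P *m exp_dd P s + (expR s)%:M = expm P + exp_dd P s *m s%:M.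
Proof.
move=> hP; have := expm_comm (upper_dd_block s hP) erefl.
rewrite (expm_block _ _ hP) mulmx1 !mulmx_block !mulmx0 !mul0mx !mulmx1 !mul1mx.
by rewrite !addr0 => /eq_block_mx[].
Qed.

(** The corner is the divided difference of x^k. For k = 0 the sum is empty, so the truncated
    predecessor is harmless. *)
Lemma dd_block_exp (n : nat) (P : 'M[R]_n) (s : R) (k : nat) :
  (block_mx P 1%:M 0 s%:M : 'M[R]_(n + n)) ^+ k =
  block_mx (P ^+ k) (\sum_(i < k) s ^+ (k.-1 - i) *: P ^+ i) 0 (s ^+ k)%:M.
Proof.
elim: k => [|k IH].
  by rewrite !expr0 big_ord0 -scalar_mx_block.
rewrite exprS IH [_ * _]mulmx_block !mulmx0 !mul0mx !mul1mx !addr0 !add0r.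
rewrite -scalar_mxM -exprS; congr (block_mx _ _ _ _); first by rewrite exprS.
rewrite big_ord_recl subn0 expr0 scalemx1 addrC; congr (_ + _).
rewrite mulmx_sumr; apply: eq_bigr => i _.
by rewrite -scalemxAr exprS; congr (_ ^+ _ *: _); case: k i {IH} => [[]|] //.
Qed.

Lemma exp_dd_entry (n : nat) (P : 'M[R]_n) (s : R) (i j : 'I_n) : upper_mx P ->
  series (fun k => inv_fact k * \sum_(l < k) s ^+ (k.-1 - l) * (P ^+ l) i j)
    @ \oo --> exp_dd P s i j.
Proof.
move=> hP; have /cvg_mxP/(_ (lshift n i) (rshift n j)) :=
  expm_cvg (upper_dd_block s hP).
rewrite (expm_block _ _ hP) mulmx1 block_mxEur.
under eq_fun do rewrite series_mxE.
move=> h; rewrite [X in series X](_ : _ = fun k => inv_fact k *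
  (block_mx P 1%:M 0 s%:M ^+ k) (lshift n i) (rshift n j)); first exact: h.
apply/funext => k; rewrite dd_block_exp block_mxEur summxE; congr (_ * _).
by apply: eq_bigr => l _; rewrite mxE.
Qed.

Lemma exp_dd_upper (n : nat) (P : 'M[R]_n) (s : R) :
  upper_mx P -> upper_mx (exp_dd P s).
Proof.
move=> hP; apply/upper_mxP => i j lji.
have /cvg_lim <- // := @exp_dd_entry _ _ s i j hP.
rewrite (_ : series _ = fun=> 0) ?lim_cst //.
apply/funext => N; rewrite /series /= big1 // => k _.
rewrite big1 ?mulr0 // => l _.
by rewrite ((upper_mxP _).1 (upperX l hP) _ _ lji) mulr0.
Qed.

Definition expR_dd (p s : R) : R :=
  if p == s then expR s else (expR p - expR s) / (p - s).

Lemma expR_dd_gt0 (p s : R) : 0 < expR_dd p s.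
Proof.
rewrite /expR_dd; case: ifPn => [_|nps]; first exact: expR_gt0.
rewrite -sgr_gt0 sgrM sgrV; move: nps; rewrite neq_lt => /orP[ps|sp].
  by rewrite !ltr0_sg ?subr_lt0 ?ltr_expR // mulrNN mulr1.
by rewrite !gtr0_sg ?subr_gt0 ?ltr_expR // mulr1.
Qed.

(** [exp_dd_mul] determines the entry only when it differs from s. When they coincide, the corner of
    the k-th power contributes k s^(k - 1) / k!, and the series is the derivative of exp. *)
Lemma exp_dd_diag (n : nat) (P : 'M[R]_n) (s : R) (i : 'I_n) :
  upper_mx P -> exp_dd P s i i = expR_dd (P i i) s.
Proof.
move=> hP; rewrite /expR_dd; case: eqVneq => [ps|nps].
  have /cvg_lim <- // := @exp_dd_entry _ _ s i i hP; apply/cvg_lim => //.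
  rewrite [X in series X](_ : _ = fun k => k%:R * inv_fact k * s ^+ k.-1).
    have := @pseries_diffs_equiv R inv_fact s.
    rewrite pseries_diffs_inv_fact expRE; apply.
    by rewrite /pseries -exp_coeffE; exact: is_cvg_series_exp_coeff.
  apply/funext => k; rewrite mulrAC mulrC; congr (_ * _).
  rewrite mulr_natl (eq_bigr (fun=> s ^+ k.-1)) => [|l _].
    by rewrite sumr_const card_ord.
  rewrite upperX_diag // ps -exprD subnK //.
  by case: k l => [[]|k l] //; rewrite -ltnS ltn_ord.
have := congr1 (fun M : 'M[R]_n => M i i) (exp_dd_mul s hP).
rewrite [LHS]mxE [RHS]mxE upperM_diag //; last exact: exp_dd_upper.
rewrite mul_mx_scalar !mxE eqxx mulr1n expm_diag // => e.
have ps0 : P i i - s != 0 by rewrite subr_eq0.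
apply: (mulIf ps0); rewrite divfK //; move: e; lra.
Qed.

Lemma exp_dd_unit (n : nat) (P : 'M[R]_n) (s : R) :
  upper_mx P -> exp_dd P s \in unitmx.
Proof.
move=> hP; apply: upper_unit; first exact: exp_dd_upper.
by move=> i; rewrite exp_dd_diag // gt_eqF // expR_dd_gt0.
Qed.

Lemma exp_dd_continuous (n : nat) (u : nat -> 'M[R]_n) (L : 'M[R]_n) (s : R) :
  (forall j, upper_mx (u j)) -> upper_mx L -> u @ \oo --> L ->
  (fun j => exp_dd (u j) s) @ \oo --> exp_dd L s.
Proof.
move=> hu hL uL; apply/cvg_mxP => i j.
have : (fun k => expm (block_mx (u k) 1%:M 0 (s%:M : 'M[R]_n))) @ \oo -->
    expm (block_mx L 1%:M 0 (s%:M : 'M[R]_n)).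
  apply: expm_continuous; [by move=> k; exact: upper_dd_block|exact: upper_dd_block|].
  apply/cvg_mxP => i' j'.
  case: (split_ordP i') => a ->; case: (split_ordP j') => b ->.
  - rewrite block_mxEul; under eq_fun do rewrite block_mxEul.
    by move/cvg_mxP: uL; apply.
  - by rewrite block_mxEur; under eq_fun do rewrite block_mxEur; exact: cvg_cst.
  - by rewrite block_mxEdl; under eq_fun do rewrite block_mxEdl; exact: cvg_cst.
  - by rewrite block_mxEdr; under eq_fun do rewrite block_mxEdr; exact: cvg_cst.
move=> /cvg_mxP/(_ (lshift n i) (rshift n j)).
by rewrite /exp_dd !mxE => h; under eq_fun do rewrite !mxE; exact: h.
Qed.

End TriangularExponential.

(** * Bijectivity of exp and the logarithm of a bordered matrix *)

Section TriangularLogarithm.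
Local Open Scope classical_set_scope.
Variable R : realType.

Lemma UT_block (n : nat) (A : 'M[R]_n) (b : 'cV[R]_n) (a : R) :
  UT (block_mx A b 0 a%:M) <-> UT A /\ 0 < a.
Proof.
split=> [[/upper_block[hA _] d]|[[hA dA] a0]].
  split; first by split=> // i; have := d (lshift 1 i); rewrite block_mxEul.
  by have := d (rshift n 0); rewrite block_mxEdr mxE eqxx mulr1n.
split; first by apply/upper_block; split=> //; exact: upper_scalar.
move=> i; case: (split_ordP i) => k ->; first by rewrite block_mxEul.
by rewrite block_mxEdr mxE eqxx mulr1n.
Qed.

Lemma upper_block1P (n : nat) (A : 'M[R]_(n + 1)) : upper_mx A ->
  A = block_mx (ulsubmx A) (ursubmx A) 0 (drsubmx A 0 0)%:M.
Proof. by move=> hA; rewrite -mx11_scalar -upper_blockP. Qed.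

Lemma expm_inj (n : nat) (L M : 'M[R]_n) :
  upper_mx L -> upper_mx M -> expm L = expm M -> L = M.
Proof.
elim: n L M => [|n IH] L M; first by rewrite [L]flatmx0 [M]flatmx0.
move: L M; rewrite -addn1 => L M hL hM.
have eL := upper_block1P hL; have eM := upper_block1P hM.
move: hL hM; rewrite eL eM {eL eM}.
move: (ulsubmx L) (ursubmx L) (drsubmx L 0 0) => P q s.
move: (ulsubmx M) (ursubmx M) (drsubmx M 0 0) => P' q' s'.
move=> /upper_block[hP _] /upper_block[hP' _].
rewrite !expm_block // => /eq_block_mx[/(IH _ _ hP hP') <- eq _ es].
have {es} es : s = s'.
  move/matrixP/(_ 0 0): es; rewrite !mxE eqxx !mulr1n; exact: expR_inj.
by move: eq; rewrite -es => /(can_inj (mulKmx (exp_dd_unit s hP))) ->.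
Qed.

Lemma expm_surj (n : nat) (A : 'M[R]_n) :
  UT A -> exists2 L, upper_mx L & expm L = A.
Proof.
elim: n A => [|n IH] A.
  by move=> _; exists 0; [apply/upper_mxP => -[]|rewrite [LHS]flatmx0 [A]flatmx0].
move: A; rewrite -addn1 => A hA.
have eA := upper_block1P hA.1; move: hA; rewrite eA {eA}.
move: (ulsubmx A) (ursubmx A) (drsubmx A 0 0) => P q a /UT_block[hP a0].
have [L hL eL] := IH _ hP.
exists (block_mx L (invmx (exp_dd L (ln a)) *m q) 0 (ln a)%:M).
  by apply/upper_block; split=> //; exact: upper_scalar.
by rewrite expm_block // eL mulKVmx ?exp_dd_unit // lnK.
Qed.

Lemma logmP (n : nat) (A : 'M[R]_n) :
  UT A -> upper_mx (logm A) /\ expm (logm A) = A.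
Proof.
move=> /expm_surj[L hL eL].
exact: (@xgetPex _ 0 [set L : 'M[R]_n | upper_mx L /\ expm L = A]
  (ex_intro _ L (conj hL eL))).
Qed.

Lemma logm_upper (n : nat) (A : 'M[R]_n) : UT A -> upper_mx (logm A).
Proof. by move/logmP => []. Qed.

Lemma logmK (n : nat) (A : 'M[R]_n) : UT A -> expm (logm A) = A.
Proof. by move/logmP => []. Qed.

Lemma expmK (n : nat) (L : 'M[R]_n) : upper_mx L -> logm (expm L) = L.
Proof.
move=> hL; have hE := UT_expm hL.
by apply: expm_inj => //; [exact: logm_upper|exact: logmK].
Qed.

Lemma logm_diag (n : nat) (A : 'M[R]_n) (i : 'I_n) :
  UT A -> logm A i i = ln (A i i).
Proof.
by move=> hA; rewrite -{2}(logmK hA) expm_diag ?expRK //; exact: logm_upper.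
Qed.

Lemma logm_block (n : nat) (A : 'M[R]_n) (b : 'cV[R]_n) (a : R) :
  UT A -> 0 < a ->
  logm (block_mx A b 0 a%:M) =
  block_mx (logm A) (invmx (exp_dd (logm A) (ln a)) *m b) 0 (ln a)%:M.
Proof.
move=> hA a0; have hL := logm_upper hA.
have hM : upper_mx (block_mx (logm A)
    (invmx (exp_dd (logm A) (ln a)) *m b) 0 ((ln a)%:M : 'M[R]_1)).
  by apply/upper_block; split=> //; exact: upper_scalar.
rewrite -[RHS]expmK // expm_block // logmK // mulKVmx ?exp_dd_unit //.
by rewrite lnK.
Qed.

Lemma UT_lead (n l : nat) (hl : (l <= n)%N) (A : 'M[R]_n) :
  UT A -> UT (lead_mx hl A).
Proof.
by move=> [hA dA]; split=> [|i]; [exact: lead_mx_upper|rewrite mxE].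
Qed.

Lemma lead_logm (n l : nat) (hl : (l <= n)%N) (A : 'M[R]_n) :
  UT A -> lead_mx hl (logm A) = logm (lead_mx hl A).
Proof.
move=> hA; have hL := logm_upper hA.
by rewrite -{2}(logmK hA) lead_expm // expmK //; exact: lead_mx_upper.
Qed.

End TriangularLogarithm.

(** * Power series of log^[1](., t) about c *)

Section LogDividedDifference.
Local Open Scope classical_set_scope.
Variable R : realType.

Lemma cvg_series_natX (q : R) :
  0 <= q < 1 -> cvgn (series (fun k => k.+1%:R * q ^+ k)).
Proof.
move=> /andP[q0 q1]; apply: nondecreasing_is_cvgn.
  by apply: nondecreasing_series => k _ _; rewrite mulr_ge0 ?exprn_ge0.
exists ((1 - q) ^- 2) => _ [N _ <-].
have p0 : 0 < (1 - q) ^+ 2 by rewrite exprn_gt0 // subr_gt0.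
rewrite -[leRHS]mul1r ler_pdivlMr //.
(* Exact partial sums; dropping the nonnegative remainder bounds them by (1 - q)^-2, the derivative
   of the geometric sum. *)
have -> : series (fun k => k.+1%:R * q ^+ k) N * (1 - q) ^+ 2 =
    1 - q ^+ N * (1 + N%:R * (1 - q)).
  rewrite /series /=; elim: N => [|N IH].
    by rewrite big_geq // mul0r expr0 mul0r addr0 mul1r subrr.
  rewrite big_nat_recr //= mulrDl IH (exprS q) -natr1; ring.
rewrite gerBl mulr_ge0 ?exprn_ge0 // addr_ge0 // mulr_ge0 // subr_ge0.
exact: ltW.
Qed.

(** Differentiation keeps the disc of convergence: terms are bounded at p, halfway between |x| and
    r, so the differentiated ones are dominated by (k + 1) (|x| / p)^k up to a constant. *)
Lemma cvg_pseries_diffs (f : R ^nat) (r : R) :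
  (forall x, `|x| < r -> cvgn (pseries f x)) ->
  forall x, `|x| < r -> cvgn (pseries (pseries_diffs f) x).
Proof.
move=> cf x xr; pose p := (`|x| + r) / 2.
have xp : `|x| < p by rewrite /p; lra.
have pr : p < r by rewrite /p; lra.
have p0 : 0 < p by apply: le_lt_trans xp.
have cp : cvgn (pseries f p) by apply: cf; rewrite gtr0_norm.
(* Boundedness is stated for every real above M, hence the bound M + 1. *)
have [M [_ bM]] := cvg_series_bounded cp.
have {}bM k : `|f k| * p ^+ k <= M + 1.
  rewrite -[p ^+ k]ger0_norm ?exprn_ge0 ?(ltW p0) // -normrM.
  by apply: (bM (M + 1)) => //; rewrite ltrDl.
have q1 : 0 <= `|x| / p < 1 by rewrite divr_ge0 ?(ltW p0) //= ltr_pdivrMr // mul1r.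
have cM := @cvg_seriesMl _ ((M + 1) / p) _ (cvg_series_natX q1).
have cM' : cvgn (series (fun k => (M + 1) / p * (k.+1%:R * (`|x| / p) ^+ k))).
  by apply/cvg_ex; eexists; exact: cM.
apply: (series_tail_le 0 _ cM').1 => k.
rewrite /pseries_diffs !normrM normrX normr_nat mulrAC.
have -> : (M + 1) / p * (k.+1%:R * (`|x| / p) ^+ k) =
    k.+1%:R * `|x| ^+ k * ((M + 1) / p ^+ k.+1).
  rewrite exprMn exprVn (exprS p); field.
  by rewrite expf_neq0 gt_eqF.
by rewrite ler_wpM2l ?mulr_ge0 ?exprn_ge0 // ler_pdivlMr ?exprn_gt0.
Qed.

Lemma is_derive0_eq (f : R -> R) (r x y : R) :
  (forall z : R, `|z| < r -> is_derive z (1 : R) f 0) ->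
  `|x| < r -> `|y| < r -> f x = f y.
Proof.
move=> df; wlog xy : x y / x <= y => [H xr yr|].
  by have [xy|/ltW yx] := leP x y; [|symmetry]; apply: H.
rewrite !ltr_norml => /andP[x1 x2] /andP[y1 y2].
have inr z : z \in `[x, y]%R -> `|z| < r.
  by rewrite in_itv /= ltr_norml => /andP[xz zy]; apply/andP; split; lra.
have [||z _] := @MVT_segment R f (fun=> 0) x y xy.
- move=> z; rewrite in_itv /= => /andP[/ltW xz /ltW zy].
  by apply/df/inr; rewrite in_itv /= xz.
- by apply: derivable_within_continuous => z /inr /df [].
by rewrite mul0r => /eqP; rewrite subr_eq0 => /eqP.
Qed.

Section Coefficients.
Variables (c mu : R).
Hypothesis c_gt0 : 0 < c.
Hypothesis mu_lt : `|mu| < c.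

Let l (k : nat) : R := (-1) ^+ k / (k.+1%:R * c ^+ k.+1).

(* With x = c + y and t = c + mu, the Taylor coefficients at y = 0 of
   (ln x - ln t) / (x - t), where ln (c + y) = ln c + \sum_k l k * y ^+ k.+1. *)
Definition log_dd_coef (k : nat) : R :=
  limn (series (fun j => l (k + j) * mu ^+ j)).
Let h := log_dd_coef.
Let H (y : R) : R := limn (pseries h y).
Let q : R := `|mu| / c.

Let q_itv : 0 <= q < 1.
Proof. by rewrite /q divr_ge0 ?(ltW c_gt0) //= ltr_pdivrMr // mul1r. Qed.

Let cvg_q : cvgn (series (fun j => q ^+ j)).
Proof.
have := @is_cvg_geometric_series R 1 q; rewrite ger0_norm; last by case/andP: q_itv.
case/andP: q_itv => _ q1 /(_ q1); rewrite (_ : geometric 1 q = (fun j => q ^+ j)) //.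
by apply/funext => j; rewrite /= mul1r.
Qed.

Let coef_bound (k j : nat) : `|l (k + j) * mu ^+ j| <= c ^- k.+1 * q ^+ j.
Proof.
have c0 i : 0 < c ^+ i by rewrite exprn_gt0.
rewrite /l !normrM normrX normrN1 expr1n mul1r normrX normfV normrM normr_nat.
rewrite (gtr0_norm (c0 _)) mulrC.
have -> : c ^- k.+1 * q ^+ j = `|mu| ^+ j * c ^- (k + j).+1.
  by rewrite /q exprMn exprVn -addSn exprD invfM mulrCA.
rewrite ler_wpM2l ?exprn_ge0 // invfM ler_piMl ?invr_ge0 ?(ltW (c0 _)) //.
by rewrite invf_le1 ?ltr0n // ler1n.
Qed.

Let coef_cvg (k : nat) :
  cvgn (series (fun j => l (k + j) * mu ^+ j)) /\
  `|h k| <= c ^- k.+1 * limn (series (fun j => q ^+ j)).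
Proof.
have cM := @cvg_seriesMl _ (c ^- k.+1) _ cvg_q.
have cM' : cvgn (series (fun j => c ^- k.+1 * q ^+ j)).
  by apply/cvg_ex; eexists; exact: cM.
have [cl bl] := series_tail_le 0 (coef_bound k) cM'; split=> //.
move: bl; rewrite /series /= !big_geq // !subr0.
by move/le_trans; apply; move/cvg_lim: cM => ->.
Qed.

(** Coefficient of y^(k + 1) in the expected identity (y - mu) H(y) = ln (c + y) - ln (c + mu),
    obtained here directly by splitting off the term j = 0. *)
Let coef_rec (k : nat) : h k - mu * h k.+1 = l k.
Proof.
have [ck _] := coef_cvg k; have [ck1 _] := coef_cvg k.+1.
have e : series (fun j => l (k + j) * mu ^+ j) \o succn =
    (fun N => l k + mu * series (fun j => l (k.+1 + j) * mu ^+ j) N).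
  apply/funext => N; rewrite /series /= big_nat_recl // addn0 expr0 mulr1.
  congr (_ + _); rewrite mulr_sumr; apply: eq_bigr => j _.
  by rewrite addnS exprS mulrCA.
have c1 : (series (fun j => l (k + j) * mu ^+ j) \o succn) @ \oo --> h k.
  by rewrite cvg_shiftS.
have c2 : (series (fun j => l (k + j) * mu ^+ j) \o succn) @ \oo -->
    l k + mu * h k.+1.
  by rewrite e; apply: cvgD; [exact: cvg_cst|apply: cvgM => //; exact: cvg_cst].
by rewrite (cvg_unique _ c1 c2) // addrK.
Qed.

Let cvg_h (y : R) : `|y| < c -> cvgn (pseries h y).
Proof.
move=> yc; pose C := limn (series (fun j => q ^+ j)).
have y1 : `| `|y| / c| < 1.
  by rewrite ger0_norm ?divr_ge0 ?(ltW c_gt0) // ltr_pdivrMr // mul1r.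
have cM := @is_cvg_geometric_series R (C / c) _ y1.
apply: (series_tail_le 0 _ cM).1 => k /=.
rewrite normrM normrX; have [_ hk] := coef_cvg k.
apply: le_trans (ler_wpM2r _ hk) _; first exact: exprn_ge0.
rewrite -/C exprMn exprVn (exprS c) le_eqVlt; apply/orP; left; apply/eqP; field.
by rewrite expf_neq0 gt_eqF.
Qed.

(** The left side is the derivative of (y - mu) H(y). By [coef_rec] its k-th coefficient is (k + 1)
    l_k = (-1)^k / c^(k + 1), which is a geometric series. *)
Let sum_identity (y : R) : `|y| < c ->
  H y + (y - mu) * limn (pseries (pseries_diffs h) y) = (c + y)^-1.
Proof.
move=> yc; have cd := cvg_pseries_diffs cvg_h yc.
have c1 := pseries_diffs_equiv cd; set H' := limn _ in c1 *.
have c2 : (fun N => pseries h y N +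
    (y * series (fun i => i%:R * h i * y ^+ i.-1) N
     - mu * pseries (pseries_diffs h) y N)) @ \oo --> H y + (y * H' - mu * H').
  apply: cvgD; first exact: cvg_h.
  by apply: cvgB; apply: cvgM => //; exact: cvg_cst.
have yc' : `|- y / c| < 1.
  by rewrite normrM normrN normfV (gtr0_norm c_gt0) ltr_pdivrMr // mul1r.
have c3 := @cvg_geometric_series R c^-1 _ yc'.
have e : (fun N => pseries h y N +
    (y * series (fun i => i%:R * h i * y ^+ i.-1) N
     - mu * pseries (pseries_diffs h) y N)) = series (geometric c^-1 (- y / c)).
  apply/funext => N; rewrite /pseries /series /= !mulr_sumr -sumrB -big_split /=.
  apply: eq_bigr => k _.
  have -> : y * (k%:R * h k * y ^+ k.-1) = k%:R * h k * y ^+ k.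
    by case: k => [|k]; rewrite ?mul0r ?mulr0 // mulrCA -exprS.
  have -> : h k = l k + mu * h k.+1 by rewrite -coef_rec subrK.
  rewrite /pseries_diffs /l -natr1 (exprS c).
  have -> : (- y / c) ^+ k = (-1) ^+ k * y ^+ k / c ^+ k.
    by rewrite -[- y]mulN1r !exprMn exprVn.
  field.
  by rewrite !natr1 pnatr_eq0 expf_neq0 gt_eqF.
rewrite e in c2; rewrite mulrBl (cvg_unique _ c2 c3) //.
have cy : c + y != 0.
  rewrite gt_eqF //; move: yc; rewrite ltr_norml => /andP[yc1 _]; lra.
field.
by rewrite cy gt_eqF //= addrC.
Qed.

Lemma log_dd_pser (x : R) : `|x - c| < c ->
  pseries h (x - c) @ \oo --> log_dd x (c + mu).
Proof.
move=> xc; suff <- : H (x - c) = log_dd x (c + mu) by exact: cvg_h.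
rewrite /log_dd; case: eqVneq => [-> | xmu].
  (* Coincident arguments: at y = mu the derivative term drops out and H(mu) = 1 / (c + mu). *)
  have := sum_identity mu_lt; rewrite subrr mul0r addr0 => <-.
  by rewrite addrC addKr.
(* [Phi] is constant on the disc; comparing y = x - c with y = mu, where the product vanishes, gives
   the quotient. *)
pose Phi (y : R) := (y - mu) * H y - ln (c + y).
have dPhi z : `|z| < c -> is_derive z (1 : R) Phi 0.
  (* Differentiating termwise at z requires convergence at some K with |z| < |K| < c. *)
  move=> zc; pose K := (`|z| + c) / 2.
  have K0 : 0 < K by rewrite divr_gt0 // ltr_wpDl.
  have zK : `|z| < `|K| by rewrite (gtr0_norm K0) /K; lra.
  have Kc : `|K| < c by rewrite (gtr0_norm K0) /K; lra.
  have cvg_dh := cvg_pseries_diffs cvg_h.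
  have dH := pseries_snd_diffs (cvg_h Kc) (cvg_dh _ Kc)
    (cvg_pseries_diffs cvg_dh Kc) zK.
  have d1 : is_derive z (1 : R) (fun y : R => y - mu) 1.
    have := is_deriveB (is_derive_id z 1) (is_derive_cst mu z 1).
    by move/is_derive_eq; apply; rewrite subr0.
  have d2 : is_derive z (1 : R) (fun y : R => c + y) 1.
    have := is_deriveD (is_derive_cst c z 1) (is_derive_id z 1).
    by move/is_derive_eq; apply; rewrite add0r.
  have cz : 0 < c + z.
    by move: zc; rewrite ltr_norml => /andP[zc1 _]; lra.
  have := is_deriveB (is_deriveM d1 dH) (is_derive1_comp (is_derive1_ln cz) d2).
  move=> /is_derive_eq; apply.
  by rewrite mulr1 -(sum_identity zc) /GRing.scale /= mulr1 [X in X - _]addrC subrr.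
have := is_derive0_eq dPhi xc mu_lt.
rewrite /Phi subrr mul0r sub0r [c + (x - c)]addrC subrK => e.
have nz : x - (c + mu) != 0 by rewrite subr_eq0.
apply: (mulIf nz); rewrite divfK // -e; ring.
Qed.

End Coefficients.
End LogDividedDifference.

(** * Identification of log^[1](T, t) with an inverse divided difference *)

Section AnalyticCalculus.
Local Open Scope classical_set_scope.
Variable R : realType.

Lemma pseries_abs_cvg (a : R ^nat) (f : R -> R) (c r rho : R) :
  (forall x, `|x - c| < r -> pseries a (x - c) @ \oo --> f x) ->
  0 < rho < r -> abs_cvg a rho.
Proof.
move=> af /andP[r0 rr]; split=> //; pose K := (rho + r) / 2.
have rK : rho < K by rewrite /K; lra.
have Kr : K < r by rewrite /K; lra.
have K0 : 0 < K by exact: lt_trans rK.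
have cK : cvgn (pseries a K).
  have := af (c + K); rewrite addrC addKr gtr0_norm // => /(_ Kr) cK.
  by apply/cvg_ex; eexists; exact: cK.
by apply: is_cvg_pseries_inside_norm cK _; rewrite !gtr0_norm.
Qed.

Lemma diag_bounded_lt (n : nat) (T : 'M[R]_n) (r : R) :
  0 < r -> (forall i, `|T i i| < r) ->
  exists2 rho, 0 < rho < r & forall i, `|T i i| < rho.
Proof.
move=> r0 dT; pose M := \big[Num.max/0]_i `|T i i|.
have Mr : M < r by exact: bigmax_lt.
have M0 : 0 <= M by exact: bigmax_ge_id.
exists ((M + r) / 2) => [|i]; first by apply/andP; split; lra.
have : `|T i i| <= M by exact: (le_bigmax _ (fun i => `|T i i|)).
lra.
Qed.

(** Inverse functions have reciprocal chord slopes, and reciprocal derivatives when the two points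
    coincide. *)
Lemma log_ddK (p t : R) : 0 < t -> log_dd (expR p) t * expR_dd p (ln t) = 1.
Proof.
move=> t0; rewrite /log_dd /expR_dd lnK //.
have -> : (p == ln t) = (expR p == t).
  by apply/eqP/eqP => [->|<-]; [rewrite lnK|rewrite expRK].
case: eqVneq => [->|ne]; first by rewrite mulVf // gt_eqF.
rewrite expRK mulrA divfK ?subr_eq0 // divff // subr_eq0.
by apply: contra_neq ne => ->; rewrite lnK.
Qed.

Lemma upper_subr_scalar (n : nat) (T : 'M[R]_n) (c : R) :
  upper_mx T -> upper_mx (T - c%:M).
Proof.
by move=> hT; rewrite -raddfN /=; apply: upperD => //; exact: upper_scalar.
Qed.

Lemma subr_scalar_diag (n : nat) (T : 'M[R]_n) (c : R) (i : 'I_n) :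
  (T - c%:M) i i = T i i - c.
Proof. by rewrite !mxE eqxx mulr1n. Qed.

Lemma cvg_mulmx (m n p : nat) (u : nat -> 'M[R]_(m, n)) (v : nat -> 'M[R]_(n, p))
    (A : 'M[R]_(m, n)) (B : 'M[R]_(n, p)) :
  u @ \oo --> A -> v @ \oo --> B -> (fun k => u k *m v k) @ \oo --> A *m B.
Proof.
move=> /cvg_mxP uA /cvg_mxP vB; apply/cvg_mxP => i j.
under eq_fun do rewrite mxE; rewrite mxE.
by apply: cvg_bigsum => l; apply: cvgM; [exact: uA|exact: vB].
Qed.

Lemma cvg_add_harmonic (x d : R) :
  (fun j : nat => x + j.+1%:R^-1 * d) @ \oo --> x.
Proof.
have : (fun j : nat => x + j.+1%:R^-1 * d) @ \oo --> x + 0 * d.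
  apply: cvgD; first exact: cvg_cst.
  by apply: cvgM; [exact: cvg_harmonic|exact: cvg_cst].
by rewrite mul0r addr0.
Qed.

(** Add diag(0, 1, ..., n - 1) / (j + 1): ties on the diagonal are broken for every j, and entries
    already distinct stay so for large j. *)
Lemma perturb_diag (n : nat) (L : 'M[R]_n) : upper_mx L ->
  exists u : nat -> 'M[R]_n, [/\ forall j, upper_mx (u j), u @ \oo --> L &
    \forall j \near \oo, forall p q, p != q -> u j p p != u j q q].
Proof.
move=> hL; pose D : 'M[R]_n := diag_mx (\row_i (i : nat)%:R).
have hD : upper_mx D.
  apply/upper_mxP => i j lji; rewrite !mxE; case: eqVneq => [e|_] //.
  by rewrite e ltnn in lji.
exists (fun j => L + j.+1%:R^-1 *: D); split=> [j||].
- by apply: upperD => //; exact: upperZ.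
- apply/cvg_mxP => p q; under eq_fun do rewrite mxE [X in _ + X]mxE.
  exact: cvg_add_harmonic.
apply: filter_forall => p; apply: filter_forall => q.
have [<-|npq] := eqVneq p q; first by apply: filterS filterT => j _; rewrite eqxx.
have npq' : (p : nat)%:R - (q : nat)%:R != 0 :> R by rewrite subr_eq0 eqr_nat.
have diff j : (L + j.+1%:R^-1 *: D) p p - (L + j.+1%:R^-1 *: D) q q =
    (L p p - L q q) + j.+1%:R^-1 * ((p : nat)%:R - (q : nat)%:R).
  by rewrite !mxE !eqxx !mulr1n; ring.
have [Lpq|nL] := eqVneq (L p p) (L q q).
  apply: filterS filterT => j _ _; rewrite -subr_eq0 diff Lpq subrr add0r.
  by rewrite mulf_neq0 // invr_eq0 pnatr_eq0.
rewrite -subr_eq0 in nL.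
have c := @cvg_add_harmonic (L p p - L q q) ((p : nat)%:R - (q : nat)%:R).
apply: filterS (cvgr_neq0 _ c nL) => j h _.
by rewrite -subr_eq0 diff.
Qed.

Lemma is_afc_log_dd (n : nat) (T B : 'M[R]_n) (t : R) :
  UT T -> 0 < t -> is_afc (fun x => log_dd x t) T B ->
  B *m exp_dd (logm T) (ln t) = 1%:M.
Proof.
(* Size 0 goes separately: [0 < r] is deduced from a diagonal entry lying in the disc. *)
case: n T B => [|n] T B hT t0; first by rewrite [LHS]flatmx0 [RHS]flatmx0.
move=> [c [r [a [af spT aB]]]]; have uT := hT.1.
have dT i : `|(T - c%:M) i i| < r.
  by rewrite subr_scalar_diag; apply/spT/upper_eigenvalueP => //; exists i.
have r0 : 0 < r by exact: le_lt_trans (dT 0).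
have [rho rr dT'] := diag_bounded_lt r0 dT.
have ha := pseries_abs_cvg af rr.
have uTc := upper_subr_scalar c uT.
have -> : B = mxpser a (T - c%:M) by rewrite -(cvg_mx_lim aB).
have hL := logm_upper hT; have eL := logmK hT.
move: (logm T) hL eL => L hL eL; rewrite -eL in uTc dT dT' *.
have [u [hu uL du]] := perturb_diag hL.
have cE := expm_continuous hu hL uL.
have cEc : (fun j => expm (u j) - c%:M) @ \oo --> expm L - c%:M.
  apply/cvg_mxP => i j; under eq_fun do rewrite mxE; rewrite mxE.
  by apply: cvgD; [move/cvg_mxP: cE; apply|exact: cvg_cst].
have uEc j : upper_mx (expm (u j) - c%:M).
  by apply: upper_subr_scalar; exact: expm_upper.
have cB := mxpser_continuous ha uEc uTc dT' cEc.
have cD := @exp_dd_continuous _ _ u L (ln t) hu hL uL.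
have cBD := cvg_mulmx cB cD.
apply: (@cvg_mx_unique _ _ \oo _ _ _ _ _ _ cBD).
have near_d : \forall j \near \oo, forall i, `|(expm (u j) - c%:M) i i| < rho.
  apply: filter_forall => i; apply: cvgr_lt (dT' i).
  by apply: cvg_norm; move/cvg_mxP: cEc; apply.
have near1 : \forall j \near \oo,
    1%:M = mxpser a (expm (u j) - c%:M) *m exp_dd (u j) (ln t).
  near=> j.
  have dj : forall i, `|(expm (u j) - c%:M) i i| < rho by near: j.
  have nj : forall p q, p != q -> u j p p != u j q q by near: j.
  have hj := hu j; have hEj := expm_upper hj.
  have hBj := mxpser_upper ha (uEc j) dj.
  have hDj := exp_dd_upper (ln t) hj.
  (* Both factors commute with exp (u j), whose diagonal is distinct because [expR] is injective. *)
  apply/esym; apply: (@upper_comm_eq _ _ (expm (u j))) => //.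
  - exact: upperM.
  - exact: upper_scalar.
  - by move=> p q /nj; apply: contra_neq; rewrite !expm_diag //; exact: expR_inj.
  - rewrite -mulmxA (exp_dd_comm _ hj); last exact/esym/expm_comm.
    rewrite !mulmxA; congr (_ *m _).
    apply: (mxpser_intertwine ha (uEc j) dj (uEc j) dj).
    by rewrite mulmxBl mulmxBr scalar_mxC.
  - by rewrite mul1mx mulmx1.
  move=> i; rewrite upperM_diag // (mxpser_diag _ ha (uEc j) dj) exp_dd_diag //.
  rewrite subr_scalar_diag expm_diag // mxE eqxx.
  have := dj i; rewrite subr_scalar_diag expm_diag // => dji.
  have [_ rhor] := andP rr.
  have /cvg_lim -> // := af _ (lt_trans dji rhor).
  exact: log_ddK.
apply: cvg_trans (near_eq_cvg near1) _; exact: cvg_cst.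
Unshelve. all: by end_near. Qed.

Lemma is_afc_log_dd_ex (n : nat) (T : 'M[R]_n) (t : R) :
  UT T -> 0 < t -> exists B, is_afc (fun x => log_dd x t) T B.
Proof.
(* The disc of centre c and radius c must contain t and the spectrum; t plus the trace exceeds half
   of each. *)
move=> [uT T0] t0; pose c := t + \sum_i T i i.
have S0 : 0 <= \sum_i T i i by apply: sumr_ge0 => i _; exact: ltW.
have c0 : 0 < c by rewrite ltr_wpDr.
have mu_lt : `|t - c| < c by rewrite ltr_norml /c; apply/andP; split; lra.
have dT i : `|T i i - c| < c.
  have Ti : T i i <= \sum_i T i i.
    by rewrite (bigD1 i) //= lerDl sumr_ge0 // => j _; exact: ltW.
  have := T0 i; rewrite ltr_norml /c => Ti0; apply/andP; split; lra.
have hp x : `|x - c| < c ->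
    pseries (log_dd_coef c (t - c)) (x - c) @ \oo --> log_dd x t.
  by move=> xc; have := log_dd_pser c0 mu_lt xc; rewrite [c + _]addrC subrK.
have dTc i : `|(T - c%:M) i i| < c by rewrite subr_scalar_diag.
have [rho rr dT'] := diag_bounded_lt c0 dTc.
exists (mxpser (log_dd_coef c (t - c)) (T - c%:M)), c, c, (log_dd_coef c (t - c)).
split=> // [l|].
  by move=> /(upper_eigenvalueP _ uT)[i <-].
apply: mxpser_cvg (pseries_abs_cvg hp rr) _ dT'.
exact: upper_subr_scalar.
Qed.

Lemma log1_mxE (n : nat) (T : 'M[R]_n) (t : R) : UT T -> 0 < t ->
  log1_mx T t = invmx (exp_dd (logm T) (ln t)).
Proof.
move=> hT t0; have hL := logm_upper hT; have uE := exp_dd_unit (ln t) hL.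
have /(@xgetPex _ 0) := is_afc_log_dd_ex hT t0.
rewrite -[xget _ _]/(log1_mx T t) => /(is_afc_log_dd hT t0) e.
by rewrite -[LHS](mulmxK uE) e mul1mx.
Qed.

End AnalyticCalculus.

(** * The Karcher equation: diagonal, leading blocks, existence and uniqueness *)

Section KarcherMean.
Variable R : realType.

Lemma UT_unit (n : nat) (A : 'M[R]_n) : UT A -> A \in unitmx.
Proof. by move=> [hA dA]; apply: upper_unit => // i; rewrite gt_eqF. Qed.

Lemma UT_mul (n : nat) (A B : 'M[R]_n) : UT A -> UT B -> UT (A *m B).
Proof.
move=> [hA dA] [hB dB]; split=> [|i]; first exact: upperM.
by rewrite upperM_diag // mulr_gt0.
Qed.

Lemma UT_inv_diag (n : nat) (A : 'M[R]_n) (i : 'I_n) :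
  UT A -> (invmx A) i i = (A i i)^-1.
Proof. by move=> [hA dA]; apply: upper_inv_diag => // j; rewrite gt_eqF. Qed.

Lemma UT_inv (n : nat) (A : 'M[R]_n) : UT A -> UT (invmx A).
Proof.
move=> hA; split=> [|i]; last by rewrite UT_inv_diag // invr_gt0; exact: hA.2.
by apply: upper_inv => [|i]; [exact: hA.1|rewrite gt_eqF //; exact: hA.2].
Qed.

Lemma upper_prod_diag (n : nat) (I : Type) (r : seq I) (A : I -> 'M[R]_n)
    (j : 'I_n) :
  (forall i, upper_mx (A i)) ->
  (\prod_(i <- r) A i) j j = \prod_(i <- r) A i j j.
Proof.
move=> hA; suff [] : upper_mx (\prod_(i <- r) A i) /\
  (\prod_(i <- r) A i) j j = \prod_(i <- r) A i j j by [].
apply: (big_rec2 (fun M x => upper_mx M /\ M j j = x)).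
  by split; [exact: upper_scalar|rewrite mxE eqxx].
move=> i x M _ [hM <-]; split; first exact: upperM.
exact: upperM_diag.
Qed.

Lemma powm_upper (n : nat) (A : 'M[R]_n) (s : R) : UT A -> upper_mx (powm A s).
Proof. by move=> hA; apply/expm_upper/upperZ/logm_upper. Qed.

Lemma powm_diag (n : nat) (A : 'M[R]_n) (s : R) (i : 'I_n) :
  UT A -> powm A s i i = expR (s * ln (A i i)).
Proof.
move=> hA; rewrite expm_diag; last exact/upperZ/logm_upper.
by rewrite mxE logm_diag.
Qed.

Lemma lead_invmx (n l : nat) (hl : (l <= n)%N) (X : 'M[R]_n) :
  UT X -> lead_mx hl (invmx X) = invmx (lead_mx hl X).
Proof.
move=> hX; have uX := UT_unit hX; have uLX := UT_unit (UT_lead hl hX).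
apply: (can_inj (mulKmx uLX)); rewrite mulmxV // -lead_mxM; last exact: (UT_inv hX).1.
by rewrite mulmxV //; apply/matrixP => i j; rewrite !mxE -val_eqE.
Qed.

Lemma sum_upper_block (n p : nat) (I : finType) (A : I -> 'M[R]_n)
    (B : I -> 'M[R]_(n, p)) (D : I -> 'M[R]_p) :
  \sum_i block_mx (A i) (B i) 0 (D i) =
  block_mx (\sum_i A i) (\sum_i B i) 0 (\sum_i D i).
Proof.
apply/matrixP => i j; rewrite summxE.
case: (split_ordP i) => k ->; case: (split_ordP j) => l ->.
- by under eq_bigr do rewrite block_mxEul; rewrite block_mxEul summxE.
- by under eq_bigr do rewrite block_mxEur; rewrite block_mxEur summxE.
- by under eq_bigr do rewrite block_mxEdl mxE; rewrite block_mxEdl mxE big1.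
- by under eq_bigr do rewrite block_mxEdr; rewrite block_mxEdr summxE.
Qed.

Section Weights.
Variables (m : nat) (w : 'I_m -> R).
Hypothesis w_gt0 : forall i, 0 < w i.
Hypothesis w_sum1 : \sum_(i < m) w i = 1.

Lemma weighted_sum_gt0 (f : 'I_m -> R) :
  (forall i, 0 < f i) -> 0 < \sum_(i < m) w i * f i.
Proof.
case: m w w_gt0 w_sum1 f => [|p] v v0 v1 f f0.
  (* Weights summing to 1 exclude m = 0. *)
  by move/eqP: v1; rewrite big_ord0 eq_sym oner_eq0.
rewrite big_ord_recl ltr_pwDl ?mulr_gt0 // sumr_ge0 // => i _.
by rewrite mulr_ge0 // ltW.
Qed.

Lemma weighted_ln_div (a : 'I_m -> R) (x : R) :
  (forall i, 0 < a i) -> 0 < x ->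
  \sum_(i < m) w i * ln (a i / x) = \sum_(i < m) w i * ln (a i) - ln x.
Proof.
move=> a0 x0; rewrite -[ln x]mul1r -w_sum1 mulr_suml -sumrB.
by apply: eq_bigr => i _; rewrite ln_div ?mulrBr // posrE.
Qed.

Lemma karcher_eq_diag (n : nat) (A : 'I_m -> 'M[R]_n) (X : 'M[R]_n) (j : 'I_n) :
  (forall i, UT (A i)) -> karcher_eq w A X ->
  X j j = expR (\sum_(i < m) w i * ln (A i j j)).
Proof.
move=> hA [hX /matrixP/(_ j j)]; rewrite summxE mxE => e.
have := weighted_ln_div (fun i => (hA i).2 j) (hX.2 j).
rewrite -[LHS](_ : \sum_(i < m) (w i *: logm (invmx X *m A i)) j j = _).
  by rewrite e => /esym/eqP; rewrite subr_eq0 => /eqP ->; rewrite lnK // posrE hX.2.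
apply: eq_bigr => i _; have hXA := UT_mul (UT_inv hX) (hA i).
rewrite mxE logm_diag // upperM_diag; [|exact: (UT_inv hX).1|exact: (hA i).1].
by rewrite UT_inv_diag // [_^-1 * _]mulrC.
Qed.

(** On triangular matrices, taking a leading block respects products, inverses and [logm]. This
    makes the recursion self-contained at each size. *)
Lemma karcher_eq_lead (n l : nat) (hl : (l <= n)%N) (A : 'I_m -> 'M[R]_n)
    (X : 'M[R]_n) :
  (forall i, UT (A i)) -> karcher_eq w A X ->
  karcher_eq w (fun i => lead_mx hl (A i)) (lead_mx hl X).
Proof.
move=> hA [hX e]; split; first exact: UT_lead.
transitivity (lead_mx hl (\sum_(i < m) w i *: logm (invmx X *m A i))).
  apply/matrixP => i j; rewrite mxE !summxE; apply: eq_bigr => p _.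
  rewrite -lead_invmx // -lead_mxM; last exact: (hA p).1.
  by rewrite -lead_logm ?mxE //; exact: UT_mul (UT_inv hX) (hA p).
by rewrite e; apply/matrixP => i j; rewrite !mxE.
Qed.

Section Block.
Variables (n : nat) (A : 'I_m -> 'M[R]_n) (b : 'I_m -> 'cV[R]_n) (a : 'I_m -> R).
Hypothesis A_UT : forall i, UT (A i).
Hypothesis a_gt0 : forall i, 0 < a i.
Variables (X : 'M[R]_n) (x : R).
Hypothesis X_UT : UT X.
Hypothesis x_gt0 : 0 < x.

(** [a i / x] is the last diagonal entry of the quotient of the bordered matrices. A general x
    serves existence, where A is not normalised; the recursion takes x = 1. *)
Let G (i : 'I_m) : 'M[R]_n := log1_mx (invmx X *m A i) (a i / x).
Let S : 'M[R]_n := \sum_(i < m) (w i * (a i / x)) *: G i.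

Let XA_UT i : UT (invmx X *m A i).
Proof. by apply: UT_mul => //; exact: UT_inv. Qed.

Let ax_gt0 i : 0 < a i / x. Proof. exact: divr_gt0. Qed.

Lemma karcher_sum_unit : S \in unitmx.
Proof.
have hE i := exp_dd_upper (ln (a i / x)) (logm_upper (XA_UT i)).
have dE i j : 0 < exp_dd (logm (invmx X *m A i)) (ln (a i / x)) j j.
  by rewrite exp_dd_diag ?expR_dd_gt0 //; exact: logm_upper.
have dE0 i j : exp_dd (logm (invmx X *m A i)) (ln (a i / x)) j j != 0.
  by rewrite gt_eqF.
have GE i := log1_mxE (XA_UT i) (ax_gt0 i).
apply: upper_unit => [|j].
  by apply: upper_sum => i; rewrite /G GE; apply/upperZ/upper_inv.
rewrite summxE gt_eqF // (eq_bigr (fun i => w i * (a i / x * G i j j))).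
  apply: weighted_sum_gt0 => i; rewrite mulr_gt0 // /G GE upper_inv_diag //.
  by rewrite invr_gt0.
by move=> i _; rewrite mxE [RHS]mulrA.
Qed.

Lemma karcher_block (y : 'cV[R]_n) :
  karcher_eq w (fun i => block_mx (A i) (b i) 0 (a i)%:M) (block_mx X y 0 x%:M)
  <-> [/\ karcher_eq w A X, \sum_(i < m) w i * ln (a i / x) = 0 &
    S *m (invmx X *m y) = \sum_(i < m) w i *: (G i *m invmx X *m b i)].
Proof.
have uX := UT_unit X_UT; have x0 : x != 0 by rewrite gt_eqF.
have hB : UT (block_mx X y 0 x%:M) by apply/UT_block.
have uB := UT_unit hB.
have term i : logm (invmx (block_mx X y 0 x%:M) *m block_mx (A i) (b i) 0 (a i)%:M) =
    block_mx (logm (invmx X *m A i))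
      (G i *m invmx X *m b i - (a i / x) *: (G i *m (invmx X *m y)))
      0 (ln (a i / x))%:M.
  (* The quotient in block form, verified below by multiplying back; its corner is affine in y,
     hence so is the corner of its logarithm. *)
  rewrite (_ : _ *m _ = block_mx (invmx X *m A i)
    (invmx X *m (b i - (a i / x) *: y)) 0 (a i / x)%:M).
    rewrite logm_block // /G log1_mxE //; congr (block_mx _ _ _ _).
    by rewrite !mulmxBr -!scalemxAr !mulmxA.
  apply: (can_inj (mulKmx uB)); rewrite mulKVmx // mulmx_block !mulmx0 !mul0mx.
  rewrite !mulKVmx // !addr0 add0r mul_mx_scalar subrK -scalar_mxM.
  by rewrite mulrCA divff // mulr1.
have sumE : \sum_(i < m) w i *:
      logm (invmx (block_mx X y 0 x%:M) *m block_mx (A i) (b i) 0 (a i)%:M) =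
    block_mx (\sum_(i < m) w i *: logm (invmx X *m A i))
      (\sum_(i < m) w i *: (G i *m invmx X *m b i) - S *m (invmx X *m y))
      0 (\sum_(i < m) w i * ln (a i / x))%:M.
  under eq_bigr do rewrite term scale_block_mx scaler0.
  rewrite sum_upper_block; congr (block_mx _ _ _ _).
    rewrite /S mulmx_suml -sumrB; apply: eq_bigr => i _.
    by rewrite scalerBr scalerA -scalemxAl.
  by rewrite raddf_sum; apply: eq_bigr => i _; rewrite scale_scalar_mx.
rewrite /karcher_eq sumE; split.
  move=> [_]; rewrite -[0 in RHS]block_mx0 => /eq_block_mx[e1 e2 _ e3].
  split=> //; last by apply/esym/eqP; rewrite -subr_eq0 e2.
  by move/matrixP/(_ 0 0): e3; rewrite !mxE eqxx mulr1n.
move=> [[_ e1] e2 e3]; split=> //.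
by rewrite e1 e2 e3 subrr raddf0 block_mx0.
Qed.

End Block.

Lemma karcher_eq_unique_ex (n : nat) (A : 'I_m -> 'M[R]_n) :
  (forall i, UT (A i)) ->
  exists2 X, karcher_eq w A X & forall Y, karcher_eq w A Y -> Y = X.
Proof.
elim: n A => [|n IH] A.
  move=> _; exists 0 => [|Y _]; last by rewrite [Y]flatmx0.
  split; last by rewrite [LHS]flatmx0.
  by split=> [|[]//]; apply/upper_mxP => -[].
move: A; rewrite -addn1 => A hA.
pose P i := ulsubmx (A i); pose b i := ursubmx (A i); pose a i := drsubmx (A i) 0 0.
have eA : A = fun i => block_mx (P i) (b i) 0 (a i)%:M.
  by apply/funext => i; apply: upper_block1P; exact: (hA i).1.
have hP i : UT (P i) /\ 0 < a i.
  by apply/(UT_block _ (b i)); have := hA i; rewrite {1}eA.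
have hPi i := (hP i).1; have a0 i := (hP i).2.
have [X kX uX] := IH P hPi.
(* Forced: [\sum_i w i * ln (a i / x) = 0] says that x is the weighted geometric mean of the
   [a i]. *)
pose x := expR (\sum_(i < m) w i * ln (a i)); have x0 : 0 < x by exact: expR_gt0.
have hX := kX.1; have uXm := UT_unit hX.
have uS := karcher_sum_unit hPi a0 hX x0.
set S := \sum_(i < m) _ in uS.
pose y := X *m invmx S *m
  \sum_(i < m) w i *: (log1_mx (invmx X *m P i) (a i / x) *m invmx X *m b i).
exists (block_mx X y 0 x%:M).
  rewrite eA; apply/karcher_block => //; split=> //.
    by rewrite weighted_ln_div // expRK subrr.
  by rewrite /y -!mulmxA mulKmx // mulKVmx // !mulmxA.
move=> Y kY; have hY := kY.1; have eY := upper_block1P hY.1.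
move: kY hY; rewrite eY {eY}.
move: (ulsubmx Y) (ursubmx Y) (drsubmx Y 0 0) => X' y' x' kY /UT_block[hX' x'0].
move: kY; rewrite eA => /karcher_block[] // kX' ex' ey'.
have eX : X' = X by exact: uX.
have ex : x' = x.
  move: ex'; rewrite weighted_ln_div // => /eqP; rewrite subr_eq0 => /eqP e.
  by rewrite /x e lnK.
move: ey'; rewrite eX ex -/S => ey'; congr (block_mx _ _ _ _).
by rewrite /y -mulmxA -ey' mulKmx // mulKVmx.
Qed.

Lemma karcherP (n : nat) (A : 'I_m -> 'M[R]_n) :
  (forall i, UT (A i)) -> karcher_eq w A (karcher w A).
Proof.
move=> hA; have [X kX _] := karcher_eq_unique_ex hA.
exact: (@xgetPex _ 0 [set X : 'M[R]_n | karcher_eq w A X] (ex_intro _ X kX)).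
Qed.

Lemma karcher_unique (n : nat) (A : 'I_m -> 'M[R]_n) (X : 'M[R]_n) :
  (forall i, UT (A i)) -> karcher_eq w A X -> karcher w A = X.
Proof.
move=> hA kX; have [Y _ uY] := karcher_eq_unique_ex hA.
by rewrite (uY _ kX); apply: uY; exact: karcherP.
Qed.

End Weights.
End KarcherMean.

Theorem theorem5p8 (R : realType) (m n : nat) (w : 'I_m -> R)
    (A : 'I_m -> 'M[R]_n)
    (w_gt0 : forall i, 0 < w i) (w_sum1 : \sum_(i < m) w i = 1)
    (A_UT : forall i, UT (A i)) :
  let X : 'M[R]_n := karcher w A in
  let D : 'M[R]_n := diag_part (\prod_(i < m) powm (A i) (w i)) in
  let A' (i : 'I_m) : 'M[R]_n := invmx D *m A i in
  let X' : 'M[R]_n := karcher w A' in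
  [/\ X = D *m X',
      unipotent_upper X',
      diag_part X' = 1%:M
    & (* l = k + 1 with 1 < l <= n *)
      forall (k : nat) (hk : (k <= n)%N) (hl : (k + 1 <= n)%N), (0 < k)%N ->
      let Xk : 'M[R]_k := lead_mx hk X' in
      let Ak (i : 'I_m) : 'M[R]_k := lead_mx hk (A' i) in
      let Al (i : 'I_m) : 'M[R]_(k + 1) := lead_mx hl (A' i) in
      let b (i : 'I_m) : 'cV[R]_k := ursubmx (Al i) in
      let a (i : 'I_m) : R := drsubmx (Al i) ord0 ord0 in
      let G (i : 'I_m) : 'M[R]_k := log1_mx (invmx Xk *m Ak i) (a i) in
      let S : 'M[R]_k := \sum_(i < m) (w i * a i) *: G i in
      let y : 'cV[R]_k :=
        Xk *m invmx S *m (\sum_(i < m) w i *: (G i *m invmx Xk *m b i)) in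
      [/\ forall i, Al i = block_mx (Ak i) (b i) 0 (a i)%:M,
          S \in unitmx
        & lead_mx hl X' = block_mx Xk y 0 1%:M]].
Proof.
move=> X D A' X'.
(* Diagonals of triangular matrices multiply, so D holds the weighted geometric means of the
   diagonal entries; dividing by them makes the diagonal of X' equal to 1. *)
pose d j := expR (\sum_(i < m) w i * ln (A i j j)).
have eD : D = diag_mx (\row_j d j).
  congr diag_mx; apply/rowP => j; rewrite !mxE upper_prod_diag; last first.
    by move=> i; exact: powm_upper.
  by rewrite /d expR_sum; apply: eq_bigr => i _; rewrite powm_diag.
have dD j : D j j = d j by rewrite eD !mxE eqxx mulr1n.
have hD : UT D.
  split=> [|j]; last by rewrite dD expR_gt0.
  apply/upper_mxP => i j lji; rewrite eD !mxE.
  by case: eqVneq => [e|//]; rewrite e ltnn in lji.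
have hA' i : UT (A' i) by apply: UT_mul => //; exact: UT_inv.
have uD := UT_unit hD.
have kX' : karcher_eq w A' X' by exact: karcherP.
have hX' := kX'.1; have uX' := UT_unit hX'.
have dX' j : X' j j = 1.
  rewrite (karcher_eq_diag w_sum1 _ hA' kX') -[RHS]expR0; congr expR.
  rewrite (eq_bigr (fun i => w i * ln (A i j j / d j))) => [|i _].
    rewrite weighted_ln_div //; [|by move=> i; exact: (A_UT i).2|exact: expR_gt0].
    by rewrite /d expRK subrr.
  rewrite upperM_diag; [|exact: (UT_inv hD).1|exact: (A_UT i).1].
  by rewrite UT_inv_diag // dD [_^-1 * _]mulrC.
split.
(* (D X')^-1 A_i = X'^-1 (D^-1 A_i), so D X' solves the equation of the A_i term by term. *)
- apply: karcher_unique => //; split; first exact: UT_mul.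
  rewrite -[RHS]kX'.2; apply: eq_bigr => i _; congr (_ *: logm _).
  have uDX : D *m X' \in unitmx by rewrite unitmx_mul uD.
  by apply: (can_inj (mulKmx uDX)); rewrite mulKVmx // -mulmxA mulKVmx // mulKVmx.
- by split=> //; exact: hX'.1.
- apply/matrixP => i j; by rewrite !mxE dX'.
move=> k hk hl _ Xk Ak Al b a G S y.
have ul_lead (M : 'M[R]_n) : ulsubmx (lead_mx hl M) = lead_mx hk M.
  by apply/matrixP => i j; rewrite !mxE; congr (M _ _); exact: val_inj.
have hAl i : UT (Al i) by exact: UT_lead.
have eAl i : Al i = block_mx (Ak i) (b i) 0 (a i)%:M.
  by rewrite -[Ak i]ul_lead; exact: upper_block1P (hAl i).1.
have hAa i : UT (Ak i) /\ 0 < a i by apply/(UT_block _ (b i)); rewrite -eAl.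
have hAk i := (hAa i).1; have a0 i := (hAa i).2.
have hXk : UT Xk by exact: UT_lead.
have uXk := UT_unit hXk.
have eXl : lead_mx hl X' = block_mx Xk (ursubmx (lead_mx hl X')) 0 1%:M.
  rewrite {1}(upper_block1P (UT_lead hl hX').1) ul_lead; congr (block_mx _ _ _ _%:M).
  by rewrite !mxE -[RHS](dX' (widen_ord hl (rshift k 0))).
(* The block lemmas are applied with x = 1, the last diagonal entry of the leading block of X'. *)
have divr1E i : a i / 1 = a i by rewrite divr1.
have uS : S \in unitmx.
  have := karcher_sum_unit w_gt0 w_sum1 hAk a0 hXk ltr01.
  by under eq_bigr do rewrite divr1E.
split=> //.
(* The leading block of size k + 1 solves its own Karcher equation, and its corner column is then
   the unique solution of the linear system in [karcher_block]. *)
have := karcher_eq_lead hl hA' kX'.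
rewrite eXl (_ : (fun i => _) =
  fun i => block_mx (Ak i) (b i) 0 (a i)%:M); last first.
  by apply/funext => i; exact: eAl.
move=> /(karcher_block w _ hAk a0 hXk ltr01)[_ _].
under eq_bigr do rewrite divr1E.
under [in RHS]eq_bigr do rewrite divr1E.
rewrite -/S => ey; congr (block_mx _ _ _ _).
by rewrite /y -mulmxA -ey mulKmx // mulKVmx.
Qed.
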